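(* Fix constants $c_5>0$, $\delta\in(0,1)$. There exist constants $c_0,C_2>0$ such that the following holds for all sufficiently large $n$. Let $B_1,\dots,B_m\in\mathbb{R}^{n\times n}$ be i.i.d. random matrices satisfying, for some $K\le n^2$, $\|B_i\|\le K$ almost surely and $\|\mathbb{E}[\mathcal B_i^*\mathcal B_i]-\mathcal I\|\le c_5/n$. If $m>c_0rK^2\log^7n$, then with probability at least $1-1/n^2$: (i) for all $X\in\mathbb{R}^{n\times n}$ of rank at most $r$, $\big|\frac1m\|\mathcal B(X)\|_2^2-\|X\|_{\mathrm F}^2\big|\le\delta\|X\|_{\mathrm F}^2$; (ii) for every convex set $\mathcal K\subseteq\mathbb{R}^{n\times n}$, every $\epsilon_2\ge0$, every $\Sigma\in\mathcal K$ of rank at most $r$ and every $y\in\mathbb{R}^m$ with $\|y-\mathcal B(\Sigma)\|_2\le\epsilon_2$, any minimizer $\hat\Sigma$ of $\min_M\|M\|_*$ subject to $\|y-\mathcal B(M)\|_2\le\epsilon_2$, $M\in\mathcal K$, satisfies $\|\hat\Sigma-\Sigma\|_{\mathrm F}\le C_2\epsilon_2/\sqrt m$.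
   Context: $\mathcal B_i(X)=\langle B_i,X\rangle=\operatorname{Tr}(B_i^\top X)$, $\mathcal B(X)=(\mathcal B_i(X))_{i=1}^m$, and $\mathcal B_i^*\mathcal B_i$ is the linear operator $X\mapsto\langle B_i,X\rangle B_i$ on $\mathbb{R}^{n\times n}$; $\mathcal I$ is the identity operator, and operator norms are with respect to the Frobenius norm. $\|B_i\|$ is the spectral norm. *)

(* Defs.v *)
From HB Require Import structures.
From mathcomp Require Import all_boot all_order all_algebra.
From mathcomp Require Import all_classical all_reals all_analysis.
From mathcomp Require Import polyrcf.
Set Implicit Arguments. Unset Strict Implicit. Unset Printing Implicit Defensive.
Import Order.TTheory GRing.Theory Num.Theory.
Local Open Scope classical_set_scope.
Local Open Scope ring_scope.

Section Defs.
Variable R : realType.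

Definition norm2 (m : nat) (v : 'cV[R]_m) : R :=
  Num.sqrt (\sum_(i < m) v i 0 ^+ 2).

Definition frob (n : nat) (X : 'M[R]_n) : R :=
  Num.sqrt (\sum_(i < n) \sum_(j < n) X i j ^+ 2).

Definition mxdot (n : nat) (A X : 'M[R]_n) : R := \tr (A^T *m X).

Definition spec_norm (n : nat) (A : 'M[R]_n) : R :=
  sup [set norm2 (A *m v) | v in [set v : 'cV[R]_n | norm2 v <= 1]].

Definition opnormF (n : nat) (L : 'M[R]_n -> 'M[R]_n) : R :=
  sup [set frob (L X) | X in [set X : 'M[R]_n | frob X <= 1]].

(* nuclear norm: sum of singular values, i.e. of the square roots of the
   eigenvalues (with multiplicity) of A^T A *)
Definition nucnorm (n : nat) (A : 'M[R]_n) : R :=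
  let p := char_poly (A^T *m A) in
  \sum_(x <- rootsR p) (mup x p)%:R * Num.sqrt x.

Definition meas (m n : nat) (B : 'I_m -> 'M[R]_n) (X : 'M[R]_n) : 'cV[R]_m :=
  \col_(i < m) mxdot (B i) X.

(* Borel sigma-algebra on R^{n x n} (generated by the coordinate maps) *)
Definition mx_measurable (n : nat) (A : set 'M[R]_n) : Prop :=
  <<s \bigcup_(ij in [set: 'I_n * 'I_n])
        [set (fun M : 'M[R]_n => M ij.1 ij.2) @^-1` S | S in measurable] >> A.

Section Random.
Context {d : measure_display} {T : measurableType d}.
Variable P : probability T R.

Definition random_mx (n : nat) (X : T -> 'M[R]_n) : Prop :=
  forall A, mx_measurable A -> measurable (X @^-1` A).

Definition iid_mx (m n : nat) (B : 'I_m -> T -> 'M[R]_n) : Prop :=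
  [/\ forall i, random_mx (B i),
      forall (A : 'I_m -> set 'M[R]_n), (forall i, mx_measurable (A i)) ->
        fine (P (\bigcap_i (B i @^-1` A i))) =
        \prod_(i < m) fine (P (B i @^-1` A i))
    & forall i j A, mx_measurable A -> P (B i @^-1` A) = P (B j @^-1` A)].

Definition EBstarB (n : nat) (B : T -> 'M[R]_n) (X : 'M[R]_n) : 'M[R]_n :=
  \matrix_(a, b) fine ('E_P[fun w => mxdot (B w) X * B w a b]).

End Random.

End Defs.

(* Main.v *)
(* Both claims follow from the isometry property for all X in the cone
   <G, X> <= sqrt R ||G|| ||X||_F (all G), which contains the matrices of rank at most R;
   the error of a nuclear norm minimizer lies in this cone with R = 8 r.

   Discretizing the entries makes the sample space finite.  By symmetrization with a
   ghost sample one fixes 2m matrices of norm at most K and exchanges pairs at random.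
   For a threshold tau the sets {i : <B_i, X> >= tau} are resolved, up to a factor
   1 + eta in tau, by an online learner: its potential is the squared Schatten norm of
   exponent about log n, whose smoothness bounds the number of mistakes by
   O(R K^2 log n / tau^2), so at most (2m + 1)^O(R K^2 log n / tau^2) sets occur.
   A Chernoff bound for each of them, summed over geometric thresholds with weights
   tau^2, compares the two halves of the sample for all X at once. *)
Require Import Defs.
From HB Require Import structures.
From mathcomp Require Import all_boot all_order all_algebra.
From mathcomp Require Import all_classical all_reals all_analysis.
From mathcomp Require Import complex polyrcf sesquilinear spectral.
From mathcomp Require Import measurable_realfun ring lra.
Set Implicit Arguments. Unset Strict Implicit. Unset Printing Implicit Defensive.
Import Order.TTheory GRing.Theory Num.Theory.
Local Open Scope classical_set_scope.
Local Open Scope ring_scope.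

(** * Frobenius inner product *)

Section Inner.
Variable R : realType.

(** For one matrix X of rank r and norm 1 the terms <B_i, X>^2 are only known to be at most r K^2.
    Concentration then fails with probability about exp(-m / (r K^2)), whose exponent is a power of
    log n: far too weak for a union bound over a net. The only complexity control is that the class
    is dual to the spectral norm. That norm is not smooth, but a Schatten norm of exponent p is,
    with constant p - 1, and it is within a factor 2 of the spectral norm once p is about log n.
    Exponents are powers of two because the squared norm of A at 2p is the norm of A^T A at p, so
    all inequalities follow by doubling, without spectral calculus. Squares are traded for threshold
    counts because a 0/1 variable has variance at most its mean. Deviations can then be measured
    relative to the total count, and only an additive term of order 1 / tau^2 remains; the weight
    tau^2 cancels it, so all O(log n) levels cost about the same. A finite sample space also settles
    measurability: an event quantified over all X is the preimage of a finite set. *)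

Lemma Cauchy_Schwarz_sum (I : finType) (a b : I -> R) :
  (\sum_i a i * b i) ^+ 2 <= (\sum_i a i ^+ 2) * (\sum_i b i ^+ 2).
Proof.
have h : 0 <= \sum_i \sum_j (a i * b j - a j * b i) ^+ 2.
  by apply: sumr_ge0 => i _; apply: sumr_ge0 => j _; exact: sqr_ge0.
suff e : \sum_i \sum_j (a i * b j - a j * b i) ^+ 2 =
    2 * ((\sum_i a i ^+ 2) * (\sum_i b i ^+ 2) - (\sum_i a i * b i) ^+ 2).
  by rewrite e in h; lra.
have e1 : (\sum_i a i ^+ 2) * (\sum_i b i ^+ 2) = \sum_i \sum_j a i ^+ 2 * b j ^+ 2.
  by rewrite big_distrlr.
have e2 : (\sum_i a i ^+ 2) * (\sum_i b i ^+ 2) = \sum_i \sum_j a j ^+ 2 * b i ^+ 2.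
  by rewrite e1 exchange_big.
have e3 : (\sum_i a i * b i) ^+ 2 = \sum_i \sum_j (a i * b i) * (a j * b j).
  by rewrite expr2 big_distrlr.
have -> : 2 * ((\sum_i a i ^+ 2) * (\sum_i b i ^+ 2) - (\sum_i a i * b i) ^+ 2) =
  (\sum_i a i ^+ 2) * (\sum_i b i ^+ 2) + (\sum_i a i ^+ 2) * (\sum_i b i ^+ 2)
   - 2 * (\sum_i a i * b i) ^+ 2 by ring.
rewrite {1}e1 e2 e3 mulr_sumr -big_split -sumrB; apply: eq_bigr => i _ /=.
rewrite mulr_sumr -big_split -sumrB; apply: eq_bigr => j _ /=; ring.
Qed.

Lemma Cauchy_Schwarz_sqrt (I : finType) (a b : I -> R) :
  \sum_i a i * b i <= Num.sqrt (\sum_i a i ^+ 2) * Num.sqrt (\sum_i b i ^+ 2).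
Proof.
have a0 : 0 <= \sum_i a i ^+ 2 by apply: sumr_ge0 => i _; exact: sqr_ge0.
rewrite -sqrtrM //; apply: (le_trans (ler_norm _)).
by rewrite -sqrtr_sqr ler_wsqrtr // Cauchy_Schwarz_sum.
Qed.

Section Fixn.
Variable n : nat.
Implicit Types A B X Y : 'M[R]_n.

Lemma mxdotE A X : mxdot A X = \sum_i \sum_j A i j * X i j.
Proof.
rewrite /mxdot /mxtrace exchange_big /=; apply: eq_bigr => i _.
by rewrite mxE; apply: eq_bigr => j _; rewrite mxE.
Qed.

Lemma mxdotC A X : mxdot A X = mxdot X A.
Proof. by rewrite !mxdotE; do 2!apply: eq_bigr => ? _; rewrite mulrC. Qed.

Lemma mxdotDl A B X : mxdot (A + B) X = mxdot A X + mxdot B X.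
Proof. by rewrite /mxdot linearD mulmxDl linearD. Qed.

Lemma mxdotNl A X : mxdot (- A) X = - mxdot A X.
Proof. by rewrite /mxdot linearN mulNmx linearN. Qed.

Lemma mxdotBl A B X : mxdot (A - B) X = mxdot A X - mxdot B X.
Proof. by rewrite mxdotDl mxdotNl. Qed.

Lemma mxdotZl (a : R) A X : mxdot (a *: A) X = a * mxdot A X.
Proof. by rewrite /mxdot linearZ -scalemxAl linearZ. Qed.

Lemma mxdotDr A X Y : mxdot A (X + Y) = mxdot A X + mxdot A Y.
Proof. by rewrite /mxdot mulmxDr linearD. Qed.

Lemma mxdotNr A X : mxdot A (- X) = - mxdot A X.
Proof. by rewrite /mxdot mulmxN linearN. Qed.

Lemma mxdotBr A X Y : mxdot A (X - Y) = mxdot A X - mxdot A Y.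
Proof. by rewrite mxdotDr mxdotNr. Qed.

Lemma mxdotZr (a : R) A X : mxdot A (a *: X) = a * mxdot A X.
Proof. by rewrite /mxdot -scalemxAr linearZ. Qed.

Lemma mxdot0l X : mxdot 0 X = 0.
Proof. by rewrite /mxdot trmx0 mul0mx linear0. Qed.

Lemma mxdot0r X : mxdot X 0 = 0.
Proof. by rewrite mxdotC mxdot0l. Qed.

Lemma frob_ge0 X : 0 <= frob X.
Proof. exact: sqrtr_ge0. Qed.

Lemma frob_sqr X : frob X ^+ 2 = mxdot X X.
Proof.
rewrite /frob sqr_sqrtr; last by do 2!apply: sumr_ge0 => ? _; exact: sqr_ge0.
by rewrite mxdotE; do 2!apply: eq_bigr => ? _; rewrite expr2.
Qed.

Lemma mxdot_ge0 X : 0 <= mxdot X X.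
Proof. by rewrite -frob_sqr sqr_ge0. Qed.

Lemma mxdot_le_frob A X : mxdot A X <= frob A * frob X.
Proof.
rewrite mxdotE /frob !pair_bigA /=.
exact: (Cauchy_Schwarz_sqrt (fun p => A p.1 p.2) (fun p => X p.1 p.2)).
Qed.

Lemma frobN X : frob (- X) = frob X.
Proof. by rewrite /frob; congr Num.sqrt; do 2!apply: eq_bigr => ? _; rewrite mxE sqrrN. Qed.

Lemma frobZ (a : R) X : frob (a *: X) = `|a| * frob X.
Proof.
apply: (@pexpIrn _ 2) => //; rewrite ?nnegrE ?mulr_ge0 ?frob_ge0 //.
by rewrite exprMn !frob_sqr mxdotZl mxdotZr real_normK ?num_real // mulrA expr2.
Qed.

Lemma frob0 : frob (0 : 'M[R]_n) = 0.
Proof. by have := frobZ 0 0; rewrite scaler0 normr0 mul0r. Qed.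

Lemma frob_eq0 X : frob X = 0 -> X = 0.
Proof.
move=> h; have := frob_sqr X; rewrite h expr0n mxdotE => /esym/eqP.
rewrite psumr_eq0 => [/allP hi|i _]; last first.
  by apply: sumr_ge0 => j _; rewrite -expr2 sqr_ge0.
apply/matrixP => i j; rewrite mxE.
have := hi i (mem_index_enum _); rewrite psumr_eq0 => [/allP hj|k _]; last first.
  by rewrite -expr2 sqr_ge0.
by have := hj j (mem_index_enum _); rewrite -expr2 sqrf_eq0 => /eqP.
Qed.

Lemma frobT X : frob X^T = frob X.
Proof.
by rewrite /frob exchange_big; congr Num.sqrt; do 2!apply: eq_bigr => ? _; rewrite mxE.
Qed.

Lemma frobD X Y : frob (X + Y) <= frob X + frob Y.
Proof.
rewrite -(@ler_pXn2r _ 2) ?nnegrE ?addr_ge0 ?frob_ge0 //.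
rewrite frob_sqr sqrrD !frob_sqr mxdotDl !mxdotDr (mxdotC Y X).
by have := mxdot_le_frob X Y; lra.
Qed.

End Fixn.
End Inner.

(** * Schatten norms of exponent [2 ^ k.+1] *)

Section Schatten.
Variables (R : realType) (n : nat).
Implicit Types A B X Y G b : 'M[R]_n.

(* [schatten k A ^+ (2 ^ k.+1) = \tr ((A^T *m A) ^+ (2 ^ k))] *)
Fixpoint schatten (k : nat) (A : 'M[R]_n) : R :=
  if k is j.+1 then Num.sqrt (schatten j (A^T *m A)) else frob A.

Lemma schatten_ge0 k A : 0 <= schatten k A.
Proof. by case: k => [|k] /=; [exact: frob_ge0|exact: sqrtr_ge0]. Qed.

Lemma schatten_sqr k A : schatten k.+1 A ^+ 2 = schatten k (A^T *m A).
Proof. by rewrite sqr_sqrtr // schatten_ge0. Qed.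

Lemma schatten_tr k A : schatten k A ^+ (2 ^ k.+1) = \tr ((A^T *m A) ^+ (2 ^ k)).
Proof.
elim: k A => [|k IH] A; first by rewrite /= frob_sqr.
rewrite expnS exprM schatten_sqr IH trmx_mul trmxK expnS exprM.
by congr (\tr (_ ^+ _)); rewrite expr2.
Qed.

Lemma tr_mulC_exp (A B : 'M[R]_n) k : \tr ((A *m B) ^+ k) = \tr ((B *m A) ^+ k).
Proof.
case: k => [|k]; first by rewrite !expr0.
have pS (X : 'M[R]_n) j : X ^+ j.+1 = X ^+ j *m X by rewrite exprSr.
have h : (A *m B) ^+ k *m A = A *m (B *m A) ^+ k.
  elim: k => [|k IH]; first by rewrite !expr0 mul1mx mulmx1.
  by rewrite !pS -mulmxA -(mulmxA A B A) mulmxA IH -!mulmxA.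
by rewrite !pS mulmxA h -mulmxA mxtrace_mulC mulmxA.
Qed.

Lemma schattenT k A : schatten k A^T = schatten k A.
Proof.
apply: (@pexpIrn _ (2 ^ k.+1)); rewrite ?expn_gt0 ?nnegrE ?schatten_ge0 //.
by rewrite !schatten_tr trmxK tr_mulC_exp.
Qed.

(* Hoelder at level [k] bounds the trace of a power of a non-symmetric matrix
   at level [k.+1], and cyclicity of the trace then gives Hoelder at [k.+1]. *)
Lemma schatten_holder_trace k :
  (forall A B, schatten k (A^T *m B) <= schatten k.+1 A * schatten k.+1 B) /\
  (forall A, \tr (A ^+ (2 ^ k.+1)) <= schatten k A ^+ (2 ^ k.+1)).
Proof.
elim: k => [|k [IHh IHt]].
  split=> [A B|A].
    rewrite -(@ler_pXn2r _ 2) ?nnegrE ?mulr_ge0 ?schatten_ge0 //.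
    rewrite [schatten 0 _]/= frob_sqr exprMn -(schattenT 1 A) -(schattenT 1 B).
    rewrite !schatten_sqr !trmxK.
    have -> : mxdot (A^T *m B) (A^T *m B) = mxdot (A *m A^T) (B *m B^T).
      by rewrite /mxdot !trmx_mul !trmxK -!mulmxA mxtrace_mulC !mulmxA.
    exact: mxdot_le_frob.
  have -> : \tr (A ^+ (2 ^ 1)) = mxdot A^T A by rewrite /mxdot trmxK.
  by apply: (le_trans (mxdot_le_frob _ _)); rewrite frobT /= expr2.
have ht A : \tr (A ^+ (2 ^ k.+2)) <= schatten k.+1 A ^+ (2 ^ k.+2).
  rewrite expnS !exprM; apply: (le_trans (IHt _)).
  rewrite ler_pXn2r ?nnegrE ?schatten_ge0 ?expn_gt0 ?exprn_ge0 ?schatten_ge0 //.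
  have -> : A ^+ 2 = (A^T)^T *m A by rewrite trmxK expr2.
  by apply: (le_trans (IHh _ _)); rewrite schattenT expr2.
split=> // A B.
rewrite -(@ler_pXn2r _ 2) ?nnegrE ?mulr_ge0 ?schatten_ge0 //.
rewrite -(schattenT k.+2 A) -(schattenT k.+2 B) exprMn !schatten_sqr !trmxK.
rewrite trmx_mul trmxK.
have hs : (A *m A^T)^T = A *m A^T by rewrite trmx_mul trmxK.
apply: le_trans (IHh (A *m A^T) (B *m B^T)); rewrite hs.
rewrite -(@ler_pXn2r _ (2 ^ k.+1)) ?expn_gt0 ?nnegrE ?schatten_ge0 //.
apply: le_trans (IHt _).
rewrite schatten_tr !trmx_mul !trmxK.
set S := B^T *m A *m (A^T *m B).
have -> : (S *m S) ^+ (2 ^ k) = S ^+ (2 ^ k.+1) by rewrite expnS exprM expr2.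
by rewrite /S -!mulmxA tr_mulC_exp -!mulmxA.
Qed.

Lemma schatten_holder k A B :
  schatten k (A^T *m B) <= schatten k.+1 A * schatten k.+1 B.
Proof. by have [h _] := schatten_holder_trace k; exact: h. Qed.

(** By doubling: the squared norm at level [k.+1] is the norm at level [k] of
    [(A + B)^T *m (A + B)], whose cross terms are controlled by [schatten_holder]. *)
Lemma schattenD k A B : schatten k (A + B) <= schatten k A + schatten k B.
Proof.
elim: k A B => [|k IH] A B; first exact: frobD.
rewrite -(@ler_pXn2r _ 2) ?nnegrE ?addr_ge0 ?schatten_ge0 //.
rewrite sqrrD !schatten_sqr [(A + B)^T]linearD mulmxDl !mulmxDr.
have h1 := IH (A^T *m A + A^T *m B) (B^T *m A + B^T *m B).
have h2 := IH (A^T *m A) (A^T *m B).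
have h3 := IH (B^T *m A) (B^T *m B).
by have := schatten_holder k A B; have := schatten_holder k B A; lra.
Qed.

(* Doubling of the exponent via [|G + b|^2 = S + H], [|G - b|^2 = S - H] with
   [S = G^T G + b^T b] and [H = G^T b + b^T G] (Tomczak-Jaegermann). *)
Lemma schatten_smooth k G b :
  schatten k (G + b) ^+ 2 + schatten k (G - b) ^+ 2 <=
  2 * (schatten k G ^+ 2 + ((2 ^ k.+1)%:R - 1) * schatten k b ^+ 2).
Proof.
elim: k G b => [|k IH] G b.
  rewrite /= !frob_sqr !(mxdotDl, mxdotNl, mxdotDr, mxdotNr) mxdotC.
  rewrite expn1; lra.
set c : R := (2 ^ k.+1)%:R - 1 in IH.
have -> : (2 ^ k.+2)%:R - 1 = 1 + 2 * c :> R by rewrite expnS natrM /c; ring.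
have c0 : 0 <= c by rewrite /c subr_ge0 ler1n expn_gt0.
set S := G^T *m G + b^T *m b; set H := G^T *m b + b^T *m G.
have e1 : (G + b)^T *m (G + b) = S + H.
  rewrite [(G + b)^T]linearD mulmxDl !mulmxDr /S /H -!addrA; congr (_ + _).
  by rewrite [RHS]addrC -!addrA.
have e2 : (G - b)^T *m (G - b) = S - H.
  by rewrite [(G - b)^T]linearB mulmxBl !mulmxBr /S /H opprB opprD addrACA.
rewrite !schatten_sqr e1 e2 -!schatten_sqr.
have hS : schatten k S <= schatten k.+1 G ^+ 2 + schatten k.+1 b ^+ 2.
  by rewrite !schatten_sqr schattenD.
have hH : schatten k H <= 2 * (schatten k.+1 G * schatten k.+1 b).
  have := schattenD k (G^T *m b) (b^T *m G).
  by have := schatten_holder k G b; have := schatten_holder k b G; rewrite -/H; lra.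
have := IH S H.
move: (schatten_ge0 k (S + H)) (schatten_ge0 k (S - H)) hS hH.
move: (schatten_ge0 k S) (schatten_ge0 k H) (schatten_ge0 k.+1 G) (schatten_ge0 k.+1 b).
move: (schatten k (S + H)) (schatten k (S - H)) (schatten k S) (schatten k H).
move: (schatten k.+1 G) (schatten k.+1 b) => x y u v s h hs hh hx hy hu hv hS hH hI.
have hS2 : s ^+ 2 <= (x ^+ 2 + y ^+ 2) ^+ 2.
  by rewrite ler_pXn2r ?nnegrE // addr_ge0 ?sqr_ge0.
have hH2 : h ^+ 2 <= (2 * (x * y)) ^+ 2.
  by rewrite ler_pXn2r ?nnegrE // !mulr_ge0.
have hcH : c * h ^+ 2 <= c * (2 * (x * y)) ^+ 2 by rewrite ler_wpM2l.
have huv : (u + v) ^+ 2 <= 2 * (u ^+ 2 + v ^+ 2).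
  by have := sqr_ge0 (u - v); rewrite !expr2; lra.
rewrite -(@ler_pXn2r _ 2) ?nnegrE ?addr_ge0 //; last first.
  by rewrite !mulr_ge0 ?addr_ge0 ?mulr_ge0 ?addr_ge0 ?sqr_ge0 ?mulr_ge0.
apply: (le_trans huv); apply: (@le_trans _ _ (4 * (s ^+ 2 + c * h ^+ 2))); first by lra.
apply: (@le_trans _ _ (4 * ((x ^+ 2 + y ^+ 2) ^+ 2 + c * (2 * (x * y)) ^+ 2))); first by lra.
(* With the new constant [1 + 2 * c] the cross terms in [x ^+ 2 * y ^+ 2] agree exactly; what is
   left over is 16 times this quantity. *)
have : 0 <= (c + c ^+ 2) * (y ^+ 2) ^+ 2 by apply: mulr_ge0; [apply: addr_ge0 => //|]; exact: sqr_ge0.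
by rewrite !expr2; lra.
Qed.

(** Spectral norm at most [c], free of the supremum in [spec_norm]. *)
Definition op_bound (A : 'M[R]_n) (c : R) := forall v : 'cV[R]_n, norm2 (A *m v) <= c * norm2 v.

Lemma norm2_ge0 m (v : 'cV[R]_m) : 0 <= norm2 v.
Proof. exact: sqrtr_ge0. Qed.

Lemma norm2_sqr m (v : 'cV[R]_m) : norm2 v ^+ 2 = \tr (v^T *m v).
Proof.
rewrite sqr_sqrtr; last by apply: sumr_ge0 => i _; exact: sqr_ge0.
by rewrite /mxtrace big_ord1 mxE; apply: eq_bigr => i _; rewrite mxE expr2.
Qed.

Lemma norm2_eq0 m (v : 'cV[R]_m) : norm2 v = 0 -> v = 0.
Proof.
move=> h; have := norm2_sqr v; rewrite h expr0n /mxtrace big_ord1 mxE => /esym/eqP.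
rewrite psumr_eq0 => [/allP hv|k _]; last by rewrite mxE -expr2 sqr_ge0.
apply/matrixP => i j; rewrite ord1 mxE; have := hv i (mem_index_enum _).
by rewrite !mxE -expr2 sqrf_eq0 => /eqP.
Qed.

Lemma norm2N m (v : 'cV[R]_m) : norm2 (- v) = norm2 v.
Proof. by rewrite /norm2; congr Num.sqrt; apply: eq_bigr => i _; rewrite mxE sqrrN. Qed.

Lemma norm2_Cauchy m (u v : 'cV[R]_m) : \tr (u^T *m v) <= norm2 u * norm2 v.
Proof.
apply: le_trans (Cauchy_Schwarz_sqrt (fun i => u i 0) (fun i => v i 0)).
by rewrite /mxtrace big_ord1 mxE; apply: ler_sum => i _; rewrite mxE.
Qed.

Lemma norm2_col A j : norm2 (col j A) ^+ 2 = \sum_i A i j ^+ 2.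
Proof.
rewrite sqr_sqrtr; last by apply: sumr_ge0 => i _; exact: sqr_ge0.
by apply: eq_bigr => i _; rewrite mxE.
Qed.

Lemma frob_sqr_col A : frob A ^+ 2 = \sum_j norm2 (col j A) ^+ 2.
Proof.
rewrite frob_sqr mxdotE exchange_big; apply: eq_bigr => j _; rewrite norm2_col.
by apply: eq_bigr => i _; rewrite expr2.
Qed.

Lemma norm2_mulmx_frob A (v : 'cV[R]_n) : norm2 (A *m v) <= frob A * norm2 v.
Proof.
have h0 (w : 'cV[R]_n) : 0 <= \sum_i w i 0 ^+ 2 by apply: sumr_ge0 => i _; exact: sqr_ge0.
rewrite /frob /norm2 -sqrtrM; last by do 2!apply: sumr_ge0 => ? _; exact: sqr_ge0.
apply: ler_wsqrtr; rewrite mulr_suml; apply: ler_sum => i _; rewrite mxE.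
exact: Cauchy_Schwarz_sum.
Qed.

Lemma norm2_mulmx_schatten k A (v : 'cV[R]_n) :
  norm2 (A *m v) <= schatten k A * norm2 v.
Proof.
elim: k A v => [|k IH] A v; first exact: norm2_mulmx_frob.
rewrite -(@ler_pXn2r _ 2) ?nnegrE ?mulr_ge0 ?schatten_ge0 ?norm2_ge0 //.
rewrite exprMn norm2_sqr trmx_mul schatten_sqr.
have -> : v^T *m A^T *m (A *m v) = v^T *m (A^T *m A *m v) by rewrite !mulmxA.
apply: (le_trans (norm2_Cauchy _ _)).
rewrite expr2 mulrC mulrA ler_wpM2r ?norm2_ge0 //.
Qed.

Lemma op_bound_schatten k A : op_bound A (schatten k A).
Proof. by move=> v; exact: norm2_mulmx_schatten. Qed.

Lemma op_boundT A c : 0 <= c -> op_bound A c -> op_bound A^T c.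
Proof.
move=> c0 hA u; have := norm2_ge0 (A^T *m u); rewrite le_eqVlt => /orP[/eqP<-|lt0].
  by rewrite mulr_ge0 ?norm2_ge0.
rewrite -(ler_pM2r lt0) -expr2 norm2_sqr trmx_mul trmxK -mulmxA.
apply: (le_trans (norm2_Cauchy _ _)).
have := hA (A^T *m u); move/(ler_wpM2l (norm2_ge0 u)) => h; apply: (le_trans h).
by rewrite mulrCA mulrA.
Qed.

Lemma op_boundM A B c c' : 0 <= c -> op_bound A c -> op_bound B c' -> op_bound (A *m B) (c * c').
Proof.
move=> c0 hA hB v; rewrite -mulmxA -mulrA; apply: (le_trans (hA _)).
by rewrite ler_wpM2l.
Qed.

Lemma norm2_delta (j : 'I_n) : norm2 (delta_mx j 0 : 'cV[R]_n) = 1.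
Proof.
rewrite /norm2 (bigD1 j) //= mxE !eqxx expr1n big1 ?addr0 ?sqrtr1 // => i /negbTE ne.
by rewrite mxE ne expr0n.
Qed.

Lemma op_bound_ge0 (c : R) A : (0 < n)%N -> op_bound A c -> 0 <= c.
Proof.
move=> n0 /(_ (delta_mx (Ordinal n0) 0)); rewrite norm2_delta mulr1.
exact/le_trans/norm2_ge0.
Qed.

Lemma frob_op_bound A c : op_bound A c -> frob A ^+ 2 <= n%:R * c ^+ 2.
Proof.
move=> hA; rewrite frob_sqr_col.
apply: (@le_trans _ _ (\sum_(j < n) c ^+ 2)); last by rewrite sumr_const card_ord mulr_natl.
apply: ler_sum => j _; have := hA (delta_mx j 0).
rewrite norm2_delta mulr1 -colE => h.
by rewrite ler_pXn2r ?nnegrE ?norm2_ge0 //; apply: le_trans h; exact: norm2_ge0.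
Qed.

Lemma schatten_op_bound k A c : 0 <= c -> op_bound A c ->
  schatten k A ^+ (2 ^ k.+1) <= n%:R * c ^+ (2 ^ k.+1).
Proof.
elim: k A c => [|k IH] A c c0 hA; first exact: frob_op_bound.
rewrite expnS !exprM schatten_sqr; apply: IH; first exact: sqr_ge0.
by rewrite expr2; apply: op_boundM => //; exact: op_boundT.
Qed.

(** The factor 2 bounds the root of [n] of order [2 ^ k.+1], the usual loss between a Schatten norm
    and the spectral norm. *)
Lemma schatten_le_op k A c : (n <= 2 ^ (2 ^ k.+1))%N -> 0 <= c -> op_bound A c ->
  schatten k A <= 2 * c.
Proof.
move=> hn c0 hA; rewrite -(@ler_pXn2r _ (2 ^ k.+1)) ?expn_gt0 ?nnegrE ?schatten_ge0 ?mulr_ge0 //.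
apply: (le_trans (schatten_op_bound k c0 hA)); rewrite exprMn ler_wpM2r ?exprn_ge0 //.
by rewrite -natrX ler_nat.
Qed.

End Schatten.

(** * Threshold sets of a linear class, by online learning with few mistakes *)

Section Online.
Variables (R : realType) (V : zmodType) (Phi : V -> R) (c : R).

(* The label whose refutation increases [Phi] least. *)
Definition predict (G b : V) : bool := Phi (G - b) + c <= Phi (G + b) - c.

(* All label sequences obtained by following [predict], with at most [k] mistakes. *)
Fixpoint labelings (l : seq V) (G : V) (k : nat) : seq (seq bool) :=
  if l is b :: l' then
    let p := predict G b in
    map (cons p) (labelings l' G k) ++
    (if k is k'.+1 then
       map (cons (~~ p)) (labelings l' (if p then G - b else G + b) k')
     else [::])
  else [:: [::]].

(** The state [G] changes only at mistakes, so a sequence is determined by the positions of its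
    mistakes. *)
Lemma size_labelings l G k : (size (labelings l G k) <= (size l).+1 ^ k)%N.
Proof.
elim: l G k => [|b l IH] G k /=; first by rewrite exp1n.
rewrite size_cat size_map; case: k => [|k]; first by rewrite /= addn0 (leq_trans (IH _ _)) // !expn0.
rewrite size_map; apply: (leq_trans (leq_add (IH _ _) (IH _ _))).
rewrite expnSr -mulnSr expnSr leq_mul //; case: (k) => // j; rewrite leq_exp2r //.
Qed.

(** The gap [Phi G - phi G] is never negative, and every mistake lowers it by at least [gam - bet].
    The prediction rule and smoothness bound the change of [Phi] by [bet - c] (or [bet + c]), while
    the refuted label moves [phi] by at least [gam - c] (or [gam + c]). Inside the margin around [c]
    both labels are accepted. *)
Lemma labelings_complete (phi : V -> R) (gam bet : R) (l : seq V) (G : V) (k : nat) :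
  {morph phi : x y / x + y} -> {morph phi : x / - x} ->
  (forall G, phi G <= Phi G) ->
  (forall b, b \in l -> forall G, Phi (G + b) + Phi (G - b) <= 2 * (Phi G + bet)) ->
  0 < gam -> bet < gam -> Phi G - phi G < k.+1%:R * (gam - bet) ->
  exists2 s, s \in labelings l G k &
    all2 (fun b (x : bool) => if x then c - gam < phi b else phi b < c + gam) l s.
Proof.
move=> phiD phiN phile + gam0 ltbg; elim: l G k => [|b l IH] G k hb hk.
  by exists [::] => //=; rewrite inE.
have hl b' : b' \in l -> forall G, Phi (G + b') + Phi (G - b') <= 2 * (Phi G + bet).
  by move=> b'l; apply: hb; rewrite inE b'l orbT.
have hbb : forall G, Phi (G + b) + Phi (G - b) <= 2 * (Phi G + bet).
  by apply: hb; rewrite mem_head.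
rewrite [labelings _ _ _]/=; set p := predict G b.
have [ok|mistake] := boolP (if p then c - gam < phi b else phi b < c + gam).
  have [s hs hall] := IH G k hl hk; exists (p :: s); last by rewrite /= ok.
  by rewrite mem_cat map_f.
set G' := if p then G - b else G + b.
have hG' : Phi G' - phi G' <= Phi G - phi G - (gam - bet).
  move: mistake; rewrite /G'; have := hbb G.
  rewrite /p /predict; case: ifP => hp h; rewrite -leNgt phiD ?phiN; first by lra.
  by move/negbT: hp; rewrite -ltNge; lra.
case: k hk => [|k] hk.
  (* No mistake is left to spend: one more would make the gap negative. *)
  exfalso; have := phile G'; rewrite mul1r in hk; lra.
have hk' : Phi G' - phi G' < k.+1%:R * (gam - bet).
  apply: (le_lt_trans hG'); rewrite ltrBlDr.
  have -> : k.+1%:R * (gam - bet) + (gam - bet) = k.+2%:R * (gam - bet) by rewrite -[k.+2%:R]natr1; ring.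
  exact: hk.
have [s hs hall] := IH G' k hl hk'; exists (~~ p :: s); last first.
  rewrite /= hall andbT; move: mistake; case: (p) => /=; rewrite -leNgt.
    by move=> h; apply: (le_lt_trans h); lra.
  by move=> h; apply: lt_le_trans h; lra.
by rewrite mem_cat map_f ?orbT.
Qed.

End Online.

(** * The learner on matrices of bounded spectral norm *)

Section ThresholdFamily.
Variables (R : realType) (n : nat) (I : finType) (b : I -> 'M[R]_n).
Variables (K s : R) (k : nat).
Hypotheses (K0 : 0 < K) (s0 : 0 < s) (hn : (n <= 2 ^ (2 ^ k.+1))%N).
Hypothesis hb : forall i, op_bound (b i) K.

(** The family is fixed before [X]: it collects the outputs of the learner over all mistake
    patterns, and [X] only selects one of them. Membership is unconstrained between [lo] and
    [hi]. *)
Lemma threshold_family (lo hi : R) (M : nat) : lo < hi ->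
  s ^+ 2 * (2 ^ k.+3)%:R * K ^+ 2 < M.+1%:R * ((hi - lo) / 2) ^+ 2 ->
  exists2 F : seq {set I}, (size F <= #|I|.+1 ^ M)%N &
    forall X : 'M[R]_n, (forall G, mxdot G X <= s * schatten k G) ->
    exists2 D, D \in F &
      forall i, if i \in D then lo < mxdot (b i) X else mxdot (b i) X < hi.
Proof.
move=> lohi hM.
pose c := (lo + hi) / 2; pose gam := (hi - lo) / 2; pose bet := gam / 2.
have gam0 : 0 < gam by rewrite /gam; lra.
(* Chosen so that one smoothness step costs exactly [bet = gam / 2]. The initial gap [s * nu / 2],
   divided by [gam - bet = gam / 2], is then the mistake bound in the hypothesis on [M]. *)
pose nu := s * (2 ^ k.+3)%:R * K ^+ 2 / gam.
have k0 : 0 < (2 ^ k.+3)%:R :> R by rewrite ltr0n expn_gt0.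
have nu0 : 0 < nu by rewrite /nu divr_gt0 // !mulr_gt0 // exprn_gt0.
(* By AM-GM this majorizes [s * schatten k G] by an expression in the squared norm, to which
   [schatten_smooth] applies. *)
pose Phi (G : 'M[R]_n) := s * (schatten k G ^+ 2 / (2 * nu) + nu / 2).
have amgm (x y : R) : 0 < y -> x <= x ^+ 2 / (2 * y) + y / 2.
  move=> y0; have -> : x ^+ 2 / (2 * y) + y / 2 = (x ^+ 2 + y ^+ 2) / (2 * y).
    by field; rewrite gt_eqF.
  rewrite ler_pdivlMr ?mulr_gt0 //.
  by have := sqr_ge0 (x - y); rewrite !expr2; lra.
have Phi_ge G : s * schatten k G <= Phi G.
  rewrite /Phi ler_pM2l //.
  exact: amgm.
have Phi0 : Phi 0 = s * nu / 2.
  have e0 : schatten k (0 : 'M[R]_n) = 0.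
    by elim: (k) => [|j IH] /=; rewrite ?frob0 // mulmx0 IH sqrtr0.
  by rewrite /Phi e0 expr0n mul0r add0r mulrA.
have smooth i G : Phi (G + b i) + Phi (G - b i) <= 2 * (Phi G + bet).
  have h := schatten_smooth k G (b i).
  have hbi : schatten k (b i) ^+ 2 <= (2 * K) ^+ 2.
    have K0' := ltW K0.
    by rewrite ler_pXn2r ?nnegrE ?schatten_ge0 ?mulr_ge0 // schatten_le_op.
  have hc : ((2 ^ k.+1)%:R - 1) * schatten k (b i) ^+ 2 <= (2 ^ k.+1)%:R * (2 * K) ^+ 2.
    by apply: ler_pM => //; rewrite ?subr_ge0 ?ler1n ?expn_gt0 ?sqr_ge0 // lerBlDr lerDl.
  have -> : bet = s * ((2 ^ k.+1)%:R * (2 * K) ^+ 2 / (2 * nu)).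
    have p0 : 0 < (2 ^ k.+1)%:R :> R by rewrite ltr0n expn_gt0.
    rewrite /bet /nu; have -> : (2 ^ k.+3)%:R = 4 * (2 ^ k.+1)%:R :> R.
      by rewrite -natrM !expnS !mulnA.
    by field; rewrite !gt_eqF.
  rewrite /Phi -mulrDr -[X in _ <= _ * X]mulrDr [2 * (s * _)]mulrCA ler_pM2l //.
  have nui : 0 < (2 * nu)^-1 by rewrite invr_gt0 mulr_gt0.
  move: h hc; move: (schatten k (G + b i) ^+ 2) (schatten k (G - b i) ^+ 2).
  move: (_ * schatten k (b i) ^+ 2) (_ * (2 * K) ^+ 2) (schatten k G ^+ 2).
  move=> e f g u v h1 h2.
  have h3 : (u + v) * (2 * nu)^-1 <= (2 * (g + f)) * (2 * nu)^-1.
    by rewrite ler_pM2r //; lra.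
  lra.
pose l := map b (enum I).
exists [seq [set i | nth false x (enum_rank i)]%SET | x <- labelings Phi c l 0 M].
  rewrite size_map (leq_trans (size_labelings _ _ _ _ _)) //.
  by rewrite size_map -cardE.
move=> X hX.
have [] := @labelings_complete R 'M[R]_n Phi c (fun G => mxdot G X) gam bet l 0 M.
- by move=> x y; rewrite mxdotDl.
- by move=> x; rewrite mxdotNl.
- by move=> G; apply: (le_trans (hX G)).
- by move=> _ /mapP[i _ ->]; exact: smooth.
- exact: gam0.
- by rewrite /bet; lra.
- rewrite Phi0 mxdot0l subr0.
  have -> : gam - bet = gam ^+ 2 / (2 * gam) by rewrite /bet; field; rewrite gt_eqF.
  have -> : s * nu / 2 = (s ^+ 2 * (2 ^ k.+3)%:R * K ^+ 2) / (2 * gam).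
    by rewrite /nu; field; rewrite gt_eqF.
  by rewrite mulrA ltr_pM2r // invr_gt0 mulr_gt0.
move=> x hx hall; exists [set i | nth false x (enum_rank i)]%SET; first exact: map_f.
move=> i; rewrite inE.
move: hall; rewrite all2E => /andP[/eqP hsz /allP hz].
have hi' : (enum_rank i < size l)%N by rewrite size_map -cardE.
have hmem : (b i, nth false x (enum_rank i)) \in zip l x.
  have -> : (b i, nth false x (enum_rank i)) = nth (0, false) (zip l x) (enum_rank i).
    rewrite nth_zip // /l (nth_map i) ?nth_enum_rank //.
    by rewrite -cardE.
  by rewrite mem_nth // size_zip -hsz minnn.
have /= := hz _ hmem.
have -> : c - gam = lo by rewrite /c /gam; field.
by have -> : c + gam = hi by rewrite /c /gam; field.
Qed.

End ThresholdFamily.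

(** * Random signs on a fixed double sample *)

Section Signs.
Variable R : realType.

(** From exp(u) <= 1 / (1 - u) the sum is at most 2 / (1 - t^2), and t^2 <= 1/4 bounds this by 2 (1
    + 2 t^2). *)
Lemma cosh_le (t : R) : `|t| <= 2^-1 -> expR t + expR (- t) <= 2 * expR (2 * t ^+ 2).
Proof.
move=> ht; have [h1 h2] : - 2^-1 <= t /\ t <= 2^-1 by apply/andP; rewrite -ler_norml.
have inv (u : R) : u <= 2^-1 -> expR u <= (1 - u)^-1.
  move=> hu; rewrite -[u]opprK expRN opprK lef_pV2 ?posrE ?expR_gt0 //; last by lra.
  by apply: le_trans (expR_ge1Dx _); lra.
apply: (@le_trans _ _ ((1 - t)^-1 + (1 - (- t))^-1)); first by rewrite lerD // inv //; lra.
have t2 : t ^+ 2 <= 4^-1.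
  have -> : 4^-1 = 2^-1 ^+ 2 :> R by field.
  by rewrite -[t ^+ 2]real_normK ?num_real // ler_pXn2r ?nnegrE // invr_ge0.
have t20 := sqr_ge0 t.
apply: (@le_trans _ _ (2 * (1 + 2 * t ^+ 2))); last first.
  by rewrite ler_pM2l // expR_ge1Dx.
have -> : (1 - t)^-1 + (1 - (- t))^-1 = 2 / (1 - t ^+ 2).
  have -> : 1 - t ^+ 2 = (1 - t) * (1 + t) by ring.
  have [p1 p2] : 0 < 1 - t /\ 0 < 1 + t by split; lra.
  by rewrite opprK; field; rewrite !gt_eqF.
rewrite ler_pdivrMr; last by lra.
have : 0 <= t ^+ 2 * (1 - 2 * t ^+ 2) by rewrite mulr_ge0 //; lra.
lra.
Qed.

Variable m : nat.
Implicit Types (sg : {ffun 'I_m -> bool}) (D : {set 'I_m * bool}).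

Definition flip sg : {ffun 'I_m -> bool} := [ffun i => ~~ sg i].

Lemma flipK : involutive flip.
Proof. by move=> sg; apply/ffunP => i; rewrite !ffunE negbK. Qed.

Definition hits sg D : R := \sum_i ((i, sg i) \in D)%:R.

Lemma hits_split sg D (i : 'I_m) :
  ((i, sg i) \in D)%:R + ((i, flip sg i) \in D)%:R =
  ((i, true) \in D)%:R + ((i, false) \in D)%:R :> R.
Proof. by rewrite ffunE; case: (sg i) => //=; rewrite addrC. Qed.

(* Chernoff bound at the fixed parameter [eta / 2]. *)
Lemma sign_deviation (eta lam : R) D : 0 < eta <= 1 ->
  \sum_(sg : {ffun 'I_m -> bool}) ((hits (flip sg) D + eta * (hits sg D + hits (flip sg) D) + lam < hits sg D)%R%:R : R)
    <= 2 ^+ m * expR (- (eta * lam / 2)) :> R.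
Proof.
move=> /andP[eta0 eta1].
pose t := eta / 2.
pose d (i : 'I_m) : R := ((i, true) \in D)%:R - ((i, false) \in D)%:R.
pose N : R := \sum_i (((i, true) \in D)%:R + ((i, false) \in D)%:R).
pose sgn (x : bool) : R := if x then 1 else -1.
have hN sg : hits sg D + hits (flip sg) D = N.
  by rewrite -big_split; apply: eq_bigr => i _; exact: hits_split.
have hZ sg : hits sg D - hits (flip sg) D = \sum_i sgn (sg i) * d i.
  rewrite -sumrB; apply: eq_bigr => i _; rewrite ffunE /sgn /d.
  by case: (sg i) => /=; ring.
apply: (@le_trans _ _ (\sum_(sg : {ffun 'I_m -> bool}) ((\prod_i expR (t * (sgn (sg i) * d i))) * expR (- (t * (eta * N + lam)))))).
  apply: ler_sum => sg _; rewrite hN -expR_sum -expRD -mulr_sumr -hZ.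
  case: ltP => [h|_]; last exact: expR_ge0.
  rewrite -[leLHS]expR0 ler_expR /t; have : 0 <= eta / 2 * (hits sg D - hits (flip sg) D - eta * N - lam).
    by rewrite mulr_ge0 //; lra.
  lra.
rewrite -mulr_suml.
have -> : \sum_(sg : {ffun 'I_m -> bool}) \prod_i expR (t * (sgn (sg i) * d i)) =
          \prod_(i < m) \sum_(x : bool) expR (t * (sgn x * d i)).
  by rewrite -(bigA_distr_bigA (fun i x => expR (t * (sgn x * d i)))).
have hprod : \prod_(i < m) \sum_(x : bool) expR (t * (sgn x * d i)) <=
    \prod_(i < m) (2 * expR (2 * t ^+ 2 * (((i, true) \in D)%:R + ((i, false) \in D)%:R))).
  apply: ler_prod => i _; apply/andP; split.
    by apply: sumr_ge0 => x _; exact: expR_ge0.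
  rewrite big_bool /sgn mul1r mulN1r mulrN.
  have hd : `|d i| <= 1.
    by rewrite /d; case: (_ \in D); case: (_ \in D); rewrite ler_norml /=; lra.
  apply: (le_trans (cosh_le _)).
    have e0 : 0 <= eta / 2 by lra.
    rewrite normrM /t (ger0_norm e0).
    move: (`|d i|) hd => x hd.
    have : 0 <= eta / 2 * (1 - x) by rewrite mulr_ge0; lra.
    lra.
  rewrite ler_pM2l // ler_expR -mulrA ler_pM2l // exprMn ler_wpM2l ?sqr_ge0 //.
  by rewrite /d; case: (_ \in D); case: (_ \in D); rewrite /= ?expr2; lra.
apply: (le_trans (ler_wpM2r (expR_ge0 _) hprod)).
rewrite big_split /= prodr_const card_ord -expR_sum -[2 ^+ m * _ * _]mulrA -expRD ler_pM2l ?exprn_gt0 //.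
(* At [t = eta / 2] the variance term [2 * t ^+ 2 * N] equals [t * eta * N], the relative part of
   the deviation, so only [t * lam] survives in the exponent. *)
rewrite ler_expR -mulr_sumr -/N /t expr2; lra.
Qed.

End Signs.

(** * Layer-cake comparison over geometric levels *)

Section Levels.
Variable R : realType.
Variables (rho theta : R).
Hypotheses (rho0 : 0 < rho) (theta1 : 1 < theta).

Definition level (j : nat) : R := rho * theta ^+ j.

(** Increments of the squared levels, so that partial sums telescope. *)
Definition weight (j : nat) : R :=
  if j is i.+1 then level i.+1 ^+ 2 - level i ^+ 2 else rho ^+ 2.

Lemma level_gt0 j : 0 < level j.
Proof. by rewrite mulr_gt0 // exprn_gt0 // (lt_trans ltr01). Qed.

Lemma levelS j : level j.+1 = theta * level j.
Proof. by rewrite /level exprS mulrCA. Qed.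

Lemma level_le i j : (i <= j)%N -> level i <= level j.
Proof. by move=> ij; rewrite ler_pM2l // ler_eXn2l. Qed.

Lemma weight_ge0 j : 0 <= weight j.
Proof.
case: j => [|j] /=; first exact: sqr_ge0.
by rewrite subr_ge0 ler_pXn2r ?nnegrE ?(ltW (level_gt0 _)) // level_le.
Qed.

Lemma weight_le j : weight j <= level j ^+ 2.
Proof. by case: j => [|j] /=; rewrite /level ?expr0 ?mulr1 // lerBlDr lerDl sqr_ge0. Qed.

Lemma sum_weight J : \sum_(j < J.+1) weight j = level J ^+ 2.
Proof.
elim: J => [|J IH]; first by rewrite big_ord1 /level expr0 mulr1.
by rewrite big_ord_recr IH /= addrC subrK.
Qed.

(** [d] may fail to be monotone: all weights up to the last level where it holds sum to the square
    of that level, which lies below [x]. *)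
Lemma layer_le (x : R) (d : nat -> bool) J :
  (forall j, d j -> level j < x) ->
  \sum_(j < J.+1) weight j * (d j)%:R <= Num.max x 0 ^+ 2.
Proof.
move=> hd; elim: J => [|J IH].
  rewrite big_ord1; case: (boolP (d 0%N)) => [h|_]; last by rewrite mulr0 sqr_ge0.
  rewrite mulr1 /= ler_pXn2r ?nnegrE ?(ltW rho0) ?le_max ?lexx ?orbT //.
  by have := hd _ h; rewrite /level expr0 mulr1 => /ltW ->.
have [h|h] := boolP (d J.+1); last by rewrite big_ord_recr /= (negbTE h) mulr0 addr0.
apply: (@le_trans _ _ (\sum_(j < J.+2) weight j)).
  by apply: ler_sum => j _; rewrite ler_piMr ?weight_ge0 // lern1 leq_b1.
rewrite sum_weight ler_pXn2r ?nnegrE ?(ltW (level_gt0 _)) ?le_max ?lexx ?orbT //.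
by rewrite (ltW (hd _ h)).
Qed.

(** One factor [theta] pays for the blurred threshold and one for the gap to the next level, both
    squared; [rho ^+ 2] pays for an [x] below the bottom level. *)
Lemma layer_ge (x : R) (d : nat -> bool) J :
  (forall j, ~~ d j -> x < theta * level j) -> x < theta ^+ 2 * level J ->
  Num.max x 0 ^+ 2 <= theta ^+ 4 * (\sum_(j < J.+1) weight j * (d j)%:R + rho ^+ 2).
Proof.
have t0 : 0 < theta by rewrite (lt_trans ltr01).
have maxsq (y : R) : 0 <= y -> x <= y -> Num.max x 0 ^+ 2 <= y ^+ 2.
  move=> y0 xy; rewrite ler_pXn2r ?nnegrE ?le_max ?lexx ?orbT //.
  by rewrite ge_max xy y0.
move=> hd; elim: J => [|J IH] hx.
  apply: (le_trans (maxsq (theta ^+ 2 * rho) _ _)).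
  - by rewrite mulr_ge0 ?sqr_ge0 ?ltW.
  - by move/ltW: hx; rewrite /level expr0 mulr1.
  rewrite exprMn -exprM ler_wpM2l ?exprn_ge0 ?(ltW t0) // big_ord1 lerDr mulr_ge0 //.
  exact: weight_ge0.
have [hJ|hJ] := ltP x (theta * level J.+1).
  move: hJ; rewrite levelS mulrA -expr2 => /IH h; apply: (le_trans h).
  rewrite ler_pM2l ?exprn_gt0 // [in leRHS]big_ord_recr lerD2r lerDl mulr_ge0 //.
  exact: weight_ge0.
have -> : \sum_(j < J.+2) weight j * (d j)%:R = level J.+1 ^+ 2.
  rewrite -sum_weight; apply: eq_bigr => j _.
  suff -> : d j by rewrite mulr1.
  apply/negPn/negP => /hd; apply/negP; rewrite -leNgt; apply: le_trans hJ.
  by rewrite ler_pM2l // level_le // -ltnS ltn_ord.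
apply: (le_trans (maxsq (theta ^+ 2 * level J.+1) _ (ltW hx))).
  by rewrite mulr_ge0 ?sqr_ge0 ?(ltW (level_gt0 _)).
by rewrite exprMn -exprM ler_pM2l ?exprn_gt0 // lerDl sqr_ge0.
Qed.

End Levels.

(** * Comparison of the two halves of a fixed double sample *)

Section Comparison.
Variables (R : realType) (n m : nat) (b : 'I_m * bool -> 'M[R]_n).
Variables (K s : R) (k J : nat) (eta rho : R).
Hypotheses (K0 : 0 < K) (s0 : 0 < s) (hn : (n <= 2 ^ (2 ^ k.+1))%N).
Hypothesis hb : forall i, op_bound (b i) K.
Hypotheses (eta01 : 0 < eta < 1) (rho0 : 0 < rho).
Let theta := 1 + eta.
Hypothesis top : 2 * (s * K) <= level rho theta J.

(** By duality, the ball of radius [s] for the Schatten norm of the conjugate exponent. *)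
Definition nuclear_class (X : 'M[R]_n) := forall G, `|mxdot G X| <= s * schatten k G.

Definition energy (sg : {ffun 'I_m -> bool}) (X : 'M[R]_n) : R :=
  \sum_i mxdot (b (i, sg i)) X ^+ 2.

Variables (M : nat -> nat) (lam : nat -> R).
Hypothesis hM : forall j, s ^+ 2 * (2 ^ k.+3)%:R * K ^+ 2 <
  (M j).+1%:R * (eta * level rho theta j / 2) ^+ 2.

Let Lam : R := \sum_(j < J.+1) weight rho theta j * lam j.

Lemma sign_comparison :
  exists2 bad : pred {ffun 'I_m -> bool},
    \sum_(sg : {ffun 'I_m -> bool}) (bad sg)%:R <=
      2 ^+ m * \sum_(j < J.+1) (2 * ((m.*2.+1 ^ M j)%:R * expR (- (eta * lam j / 2)))) :> R &
    forall sg X, ~~ bad sg -> nuclear_class X ->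
      energy sg X <= theta ^+ 4 / (1 - eta) *
        ((1 + eta) * energy (flip sg) X + 2 * (Lam + m%:R * rho ^+ 2)) /\
      energy (flip sg) X <= theta ^+ 4 / (1 - eta) *
        ((1 + eta) * energy sg X + 2 * (Lam + m%:R * rho ^+ 2)).
Proof.
have /andP[eta0 eta1] := eta01.
have theta1 : 1 < theta by rewrite /theta; lra.
have theta0 : 0 < theta by lra.
have cardI : #|{: 'I_m * bool}| = m.*2 by rewrite card_prod card_ord card_bool muln2.
(* The families depend on the [2m] matrices but not on the signs, which is what allows a union bound
   over them. *)
have fam j : exists F : seq {set 'I_m * bool}, (size F <= m.*2.+1 ^ M j)%N /\
    forall X, nuclear_class X -> exists2 D, D \in F &
      forall i, if i \in D then level rho theta j < mxdot (b i) X
                else mxdot (b i) X < theta * level rho theta j.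
  have lv := level_gt0 rho0 theta1 j.
  have [||F hF hX] := threshold_family K0 s0 hn hb (lo := level rho theta j)
     (hi := theta * level rho theta j) (M := M j).
  - by rewrite /theta mulrDl mul1r ltrDl mulr_gt0 //; lra.
  - have -> : theta * level rho theta j - level rho theta j = eta * level rho theta j.
      by rewrite /theta; ring.
    exact: hM.
  exists F; split; first by rewrite -cardI.
  move=> X hX'; apply: hX => G; exact: le_trans (ler_norm _) (hX' G).
have [F hF] := choice fam.
pose dev (sg : {ffun 'I_m -> bool}) (D : {set 'I_m * bool}) (j : nat) : bool :=
  (hits R (flip sg) D + eta * (hits R sg D + hits R (flip sg) D) + lam j < hits R sg D).
pose bad (sg : {ffun 'I_m -> bool}) := [exists j : 'I_J.+1, has (fun D => dev sg D j || dev (flip sg) D j) (F j)].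
exists bad.
  have h1 : \sum_(sg : {ffun 'I_m -> bool}) ((bad sg)%:R : R) <=
      \sum_(sg : {ffun 'I_m -> bool}) \sum_(j < J.+1) \sum_(D <- F j) ((dev sg D j)%:R + (dev (flip sg) D j)%:R).
    apply: ler_sum => sg _; rewrite /bad.
    have dev0 (j : 'I_J.+1) D : 0 <= ((dev sg D j)%:R + (dev (flip sg) D j)%:R : R) by rewrite addr_ge0.
    case: existsP => [[j /hasP[D DF hD]]|_]; last first.
      by apply: sumr_ge0 => j _; apply: sumr_ge0.
    rewrite (bigD1 j) //= (big_rem D) //=.
    have : 1 <= (dev sg D j)%:R + (dev (flip sg) D j)%:R :> R.
      by move: hD; case: (dev sg D j) => /=; [rewrite lerDl|move=> ->; rewrite add0r].
    have : 0 <= \sum_(D <- rem D (F j)) ((dev sg D j)%:R + (dev (flip sg) D j)%:R : R).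
      by apply: sumr_ge0.
    have : 0 <= \sum_(i < J.+1 | i != j) \sum_(D <- F i) ((dev sg D i)%:R + (dev (flip sg) D i)%:R : R).
      by apply: sumr_ge0 => i _; apply: sumr_ge0.
    lra.
  apply: (le_trans h1); rewrite exchange_big mulr_sumr; apply: ler_sum => j _.
  rewrite exchange_big /=.
  have hD D : \sum_(sg : {ffun 'I_m -> bool}) ((dev sg D j)%:R + (dev (flip sg) D j)%:R : R) <=
      2 * (2 ^+ m * expR (- (eta * lam j / 2))).
    have hdev := sign_deviation (lam j) D (_ : 0 < eta <= 1).
    rewrite big_split /= [X in _ + X](reindex_inj (inv_inj (@flipK m))) /=.
    under [X in _ + X]eq_bigr => sg _ do rewrite flipK.
    have h : 0 < eta <= 1 by lra.
    by have := hdev h; rewrite /dev; lra.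
  apply: (le_trans (ler_sum _ (fun D _ => hD D))).
  rewrite big_const_seq count_predT iter_addr addr0 -[_ *+ size _]mulr_natl.
  have : (size (F j))%:R <= (m.*2.+1 ^ M j)%:R :> R by rewrite ler_nat (hF j).1.
  have Y0 : 0 <= 2 * (2 ^+ m * expR (- (eta * lam j / 2))) by rewrite !mulr_ge0 ?exprn_ge0 ?expR_ge0.
  move/(ler_wpM2r Y0) => h; apply: (le_trans h).
  by rewrite le_eqVlt; apply/orP; left; apply/eqP; ring.
have bad_flip sg : bad (flip sg) = bad sg.
  by apply: eq_existsb => j; apply: eq_has => D; rewrite flipK orbC.
suff one sg X : ~~ bad sg -> nuclear_class X ->
    energy sg X <= theta ^+ 4 / (1 - eta) *
      ((1 + eta) * energy (flip sg) X + 2 * (Lam + m%:R * rho ^+ 2)).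
  move=> sg X hbad hX; split; first exact: one.
  by have := one (flip sg) X; rewrite bad_flip flipK; exact.
move=> hbad hX.
(* Threshold sets see only the positive part of <b, Y>; the cases [Y = X] and [Y = - X] together
   recover the square. *)
have half Y : nuclear_class Y ->
   \sum_i Num.max (mxdot (b (i, sg i)) Y) 0 ^+ 2 <= theta ^+ 4 / (1 - eta) *
     ((1 + eta) * \sum_i Num.max (mxdot (b (i, flip sg i)) Y) 0 ^+ 2 + (Lam + m%:R * rho ^+ 2)).
  move=> hY.
  have [D hD] := choice (fun j => let: ex_intro2 D h1 h2 := (hF j).2 Y hY in
     ex_intro (fun D => D \in F j /\ _) D (conj h1 h2)).
  pose S sg' := \sum_(j < J.+1) weight rho theta j * hits R sg' (D j).
  have SE sg' : S sg' = \sum_(i < m) \sum_(j < J.+1) weight rho theta j * ((i, sg' i) \in D j)%:R.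
    rewrite exchange_big; apply: eq_bigr => j _; by rewrite mulr_sumr.
  have Sup (sg' : {ffun 'I_m -> bool}) : S sg' <= \sum_i Num.max (mxdot (b (i, sg' i)) Y) 0 ^+ 2.
    rewrite SE; apply: ler_sum => i _.
    apply: (layer_le rho0 theta1 J (d := fun j => (i, sg' i) \in D j)) => j hj.
    by have := (hD j).2 (i, sg' i); rewrite hj.
  have Slow (sg' : {ffun 'I_m -> bool}) : \sum_i Num.max (mxdot (b (i, sg' i)) Y) 0 ^+ 2 <= theta ^+ 4 * (S sg' + m%:R * rho ^+ 2).
    have -> : m%:R * rho ^+ 2 = \sum_(i < m) rho ^+ 2 by rewrite sumr_const card_ord mulr_natl.
    rewrite SE -big_split mulr_sumr; apply: ler_sum => i _ /=.
    apply: (layer_ge rho0 theta1 (d := fun j => (i, sg' i) \in D j)) => [j hj|].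
      by have := (hD j).2 (i, sg' i); rewrite (negbTE hj).
    have lv := level_gt0 rho0 theta1 J.
    apply: (@le_lt_trans _ _ (level rho theta J)); last first.
      by rewrite ltr_pMl // expr_gt1 // ltW.
    apply: le_trans top; apply: (le_trans (ler_norm _)); apply: (le_trans (hY _)).
    rewrite mulrCA ler_pM2l //; exact: schatten_le_op hn (ltW K0) (hb _).
  (* Off the bad event no set of the families deviates. Solving this weighted sum for [S sg]
     produces the factors [1 + eta] and [1 / (1 - eta)]. *)
  have hdev : S sg <= S (flip sg) + eta * (S sg + S (flip sg)) + Lam.
    rewrite /S /Lam -!big_split /= mulr_sumr -!big_split /=; apply: ler_sum => j _.
    move: hbad; rewrite /bad negb_exists => /forallP/(_ j)/hasPn/(_ _ (hD j).1).
    rewrite negb_or => /andP[]; rewrite /dev -leNgt => h _.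
    by have := ler_wpM2l (weight_ge0 rho0 theta1 j) h; lra.
  have e1 : 0 < 1 - eta by lra.
  apply: (le_trans (Slow sg)); rewrite -[in leRHS]mulrA ler_pM2l ?exprn_gt0 //.
  rewrite [leRHS]mulrC ler_pdivlMr //.
  have h1 : 0 <= eta * (m%:R * rho ^+ 2) by rewrite !mulr_ge0 ?sqr_ge0 // ltW.
  have := ler_wpM2l (_ : 0 <= 1 + eta) (Sup (flip sg)) => /(_ (addr_ge0 ler01 (ltW eta0))).
  lra.
have hNX : nuclear_class (- X) by move=> G; rewrite mxdotNr normrN; exact: hX.
have split_sq (x : R) : x ^+ 2 = Num.max x 0 ^+ 2 + Num.max (- x) 0 ^+ 2.
  have [h|/ltW h] := lerP 0 x.
    by rewrite [Num.max (- x) 0]max_r ?oppr_le0 // expr0n addr0.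
  by rewrite [Num.max (- x) 0]max_l ?oppr_ge0 // expr0n add0r sqrrN.
have en (sg' : {ffun 'I_m -> bool}) : energy sg' X = \sum_i Num.max (mxdot (b (i, sg' i)) X) 0 ^+ 2 +
     \sum_i Num.max (mxdot (b (i, sg' i)) (- X)) 0 ^+ 2.
  by rewrite -big_split; apply: eq_bigr => i _ /=; rewrite mxdotNr -split_sq.
rewrite !en; have := half _ hX; have := half _ hNX.
move: (theta ^+ 4 / (1 - eta)) => c; lra.
Qed.

End Comparison.

(** * Finite product distributions and ghost samples *)

Section FiniteLaw.
Variables (R : realType) (F : finType) (p : F -> R) (m : nat).
Hypotheses (p0 : forall f, 0 <= p f) (p1 : \sum_f p f = 1).
Notation sample := {ffun 'I_m -> F}.

Definition law (w : sample) : R := \prod_i p (w i).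

Lemma law_ge0 w : 0 <= law w.
Proof. by apply: prodr_ge0. Qed.

Lemma law_prod (h : 'I_m -> F -> R) :
  \sum_(w : sample) law w * \prod_i h i (w i) = \prod_i \sum_f p f * h i f.
Proof.
rewrite (bigA_distr_bigA (fun i f => p f * h i f)).
by apply: eq_bigr => w _; rewrite -big_split.
Qed.

Lemma law_sum1 : \sum_(w : sample) law w = 1.
Proof.
transitivity (\prod_(i < m) \sum_f p f * 1).
  by rewrite -(law_prod (fun _ _ => 1)); apply: eq_bigr => w _; rewrite big1 ?mulr1.
by rewrite big1 // => i _; rewrite -mulr_suml p1 mulr1.
Qed.

Lemma law_pair (i j : 'I_m) (g : F -> R) : \sum_f p f * g f = 0 ->
  \sum_(w : sample) law w * (g (w i) * g (w j)) = (i == j)%:R * \sum_f p f * g f ^+ 2.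
Proof.
move=> g0.
pose h (l : 'I_m) f := (if l == i then g f else 1) * (if l == j then g f else 1).
have hE (w : sample) : g (w i) * g (w j) = \prod_l h l (w l).
  rewrite big_split /= -!big_mkcond /= !big_pred1_eq //.
under eq_bigr => w _ do rewrite hE.
rewrite law_prod; have [ij|ne] := eqVneq i j; first rewrite /h -ij.
  rewrite mul1r (bigD1 i) //= [X in _ * X]big1 ?mulr1 => [|l /negbTE li].
    by apply: eq_bigr => f _; rewrite eqxx expr2.
  by rewrite -[RHS]p1; apply: eq_bigr => f _; rewrite li !mulr1.
rewrite mul0r (bigD1 i) //= [X in X * _](_ : _ = 0) ?mul0r //.
by rewrite -[RHS]g0; apply: eq_bigr => f _; rewrite /h eqxx (negbTE ne) mulr1.
Qed.

Lemma law_chebyshev (v : F -> R) (e t : R) : e = \sum_f p f * v f -> 0 < t ->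
  \sum_(w : sample) law w * (t < `|\sum_i v (w i) - m%:R * e|)%R%:R <=
  m%:R * (\sum_f p f * v f ^+ 2) / t ^+ 2.
Proof.
move=> eE t0; pose g f := v f - e.
have g0 : \sum_f p f * g f = 0.
  under eq_bigr => f _ do rewrite mulrBr.
  by rewrite sumrB -mulr_suml p1 mul1r -eE subrr.
have gE (w : sample) : \sum_i v (w i) - m%:R * e = \sum_i g (w i).
  by rewrite /g sumrB sumr_const card_ord mulr_natl.
apply: (@le_trans _ _ (\sum_(w : sample) law w * ((\sum_i g (w i)) ^+ 2 / t ^+ 2))).
  apply: ler_sum => w _; rewrite ler_wpM2l ?law_ge0 // gE.
  case: ltP => [h|_]; last by rewrite divr_ge0 ?sqr_ge0.
  rewrite ler_pdivlMr ?exprn_gt0 // mul1r -[leRHS]real_normK ?num_real //.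
  by rewrite ler_pXn2r ?nnegrE ?(ltW t0) // ltW.
have -> : \sum_(w : sample) law w * ((\sum_i g (w i)) ^+ 2 / t ^+ 2) =
    (m%:R * \sum_f p f * g f ^+ 2) / t ^+ 2.
  under eq_bigr => w _ do rewrite mulrA.
  rewrite -mulr_suml; congr (_ / _).
  transitivity (\sum_(i < m) \sum_(j < m) \sum_(w : sample) law w * (g (w i) * g (w j))).
    under [RHS]eq_bigr => i _ do rewrite exchange_big.
    rewrite exchange_big; apply: eq_bigr => w _.
    rewrite expr2 big_distrlr mulr_sumr; apply: eq_bigr => i _.
    by rewrite mulr_sumr.
  transitivity (\sum_(i < m) \sum_f p f * g f ^+ 2); last by rewrite sumr_const card_ord mulr_natl.
  apply: eq_bigr => i _; rewrite (bigD1 i) //= (law_pair i i g0) eqxx mul1r [X in _ + X]big1 ?addr0 // => j ji.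
  by rewrite (law_pair i j g0) eq_sym (negbTE ji) mul0r.
rewrite ler_pM2r ?invr_gt0 ?exprn_gt0 // ler_wpM2l //.
have -> : \sum_f p f * g f ^+ 2 = \sum_f p f * v f ^+ 2 - e ^+ 2.
  have -> : e ^+ 2 = 2 * e * (\sum_f p f * v f) - e ^+ 2 * \sum_f p f by rewrite p1 -eE; ring.
  rewrite !mulr_sumr -!sumrB; apply: eq_bigr => f _; rewrite /g; ring.
by rewrite lerBlDr lerDl sqr_ge0.
Qed.

Definition swap (sg : {ffun 'I_m -> bool}) (w : sample * sample) : sample * sample :=
  ([ffun i => if sg i then w.1 i else w.2 i], [ffun i => if sg i then w.2 i else w.1 i]).

Lemma swapK sg : involutive (swap sg).
Proof.
by move=> [w w']; congr (_, _); apply/ffunP => i; rewrite !ffunE /=; case: (sg i); rewrite ?ffunE.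
Qed.

Lemma law_swap sg w : law (swap sg w).1 * law (swap sg w).2 = law w.1 * law w.2.
Proof.
rewrite -!big_split; apply: eq_bigr => i _ /=; rewrite !ffunE.
by case: (sg i) => //; rewrite mulrC.
Qed.

(** Each [swap sg] preserves the product law, so one may average over the signs first, with the
    double sample fixed. *)
Lemma symmetrization (Q : pred (sample * sample)) (eps : R) :
  (forall w, \sum_(sg : {ffun 'I_m -> bool}) (Q (swap sg w))%:R <= 2 ^+ m * eps :> R) ->
  \sum_w law w.1 * law w.2 * (Q w)%:R <= eps.
Proof.
move=> hQ; have e2 : 0 < 2 ^+ m :> R by rewrite exprn_gt0.
rewrite -(ler_pM2l e2).
have -> : 2 ^+ m * \sum_w law w.1 * law w.2 * (Q w)%:R =
    \sum_(sg : {ffun 'I_m -> bool}) \sum_w law w.1 * law w.2 * (Q (swap sg w))%:R.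
  transitivity (\sum_(sg : {ffun 'I_m -> bool}) \sum_w law w.1 * law w.2 * (Q w)%:R).
    by rewrite sumr_const card_ffun card_bool card_ord -[RHS]mulr_natl natrX.
  apply: eq_bigr => sg _; rewrite (reindex_inj (inv_inj (swapK sg))).
  by apply: eq_bigr => w _; rewrite law_swap.
rewrite exchange_big /=.
apply: (@le_trans _ _ (\sum_w law w.1 * law w.2 * (2 ^+ m * eps))).
  by apply: ler_sum => w _; rewrite -mulr_sumr ler_wpM2l ?mulr_ge0 ?law_ge0.
rewrite -mulr_suml -(pair_bigA _ (fun w w' => law w * law w')) /=.
under eq_bigr => w _ do rewrite -mulr_sumr law_sum1 mulr1.
by rewrite law_sum1 mul1r.
Qed.

(* [good w w'] says that the ghost sample [w'] certifies the badness of [w]. *)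
Lemma ghost_sample (bad : pred sample) (good : sample -> pred sample)
    (Q : pred (sample * sample)) (eps : R) :
  (forall w, bad w -> \sum_w' law w' * (~~ good w w')%:R <= 2^-1) ->
  (forall w w', bad w -> good w w' -> Q (w, w')) ->
  \sum_w law w.1 * law w.2 * (Q w)%:R <= eps ->
  \sum_w law w * (bad w)%:R <= 2 * eps.
Proof.
move=> hgood hQ heps; suff : 2^-1 * \sum_w law w * (bad w)%:R <= eps by lra.
apply: le_trans heps.
have -> : \sum_w law w.1 * law w.2 * (Q w)%:R = \sum_w \sum_w' law w * law w' * (Q (w, w'))%:R.
  by rewrite pair_bigA; apply: eq_bigr => -[w w'].
rewrite mulr_sumr.
apply: ler_sum => w _; have [bw|_] := boolP (bad w); last first.
  by rewrite !mulr0; apply: sumr_ge0 => w' _; rewrite !mulr_ge0 ?law_ge0.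
under eq_bigr => w' _ do rewrite -mulrA.
rewrite -mulr_sumr mulr1 mulrC ler_wpM2l ?law_ge0 //.
apply: (@le_trans _ _ (\sum_w' law w' * (good w w')%:R)); last first.
  apply: ler_sum => w' _; rewrite ler_wpM2l ?law_ge0 // ler_nat.
  by have [g|//] := boolP (good w w'); rewrite (hQ _ _ bw g).
have : \sum_w' law w' * (good w w')%:R = 1 - \sum_w' law w' * (~~ good w w')%:R.
  rewrite -[X in X - _]law_sum1 -sumrB; apply: eq_bigr => w' _.
  by case: (good w w'); rewrite ?mulr1 ?mulr0 ?subr0 ?subrr.
have := hgood _ bw; lra.
Qed.

End FiniteLaw.

(** * Restricted isometry for a finitely supported law *)

Section FiniteRIP.
Variables (R : realType) (n m : nat) (F : finType) (p : F -> R) (b : F -> 'M[R]_n).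
Hypotheses (p0 : forall f, 0 <= p f) (p1 : \sum_f p f = 1).
Variables (K s : R) (k J : nat) (eta rho : R).
Hypotheses (K0 : 0 < K) (s0 : 0 < s) (hn : (n <= 2 ^ (2 ^ k.+1))%N) (m0 : (0 < m)%N).
Hypothesis hb : forall f, op_bound (b f) K.
Hypotheses (eta01 : 0 < eta < 1) (rho0 : 0 < rho).
Let theta := 1 + eta.
Hypothesis top : 2 * (s * K) <= level rho theta J.
Variables (M : nat -> nat) (lam : nat -> R).
Hypothesis hM : forall j, s ^+ 2 * (2 ^ k.+3)%:R * K ^+ 2 <
  (M j).+1%:R * (eta * level rho theta j / 2) ^+ 2.
Let Lam : R := \sum_(j < J.+1) weight rho theta j * lam j.
Hypothesis hLam : Lam + m%:R * rho ^+ 2 <= eta * m%:R.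
Hypothesis second_moment : forall X, frob X = 1 ->
  `|\sum_f p f * mxdot (b f) X ^+ 2 - 1| <= eta.
Hypothesis m_large : 16 * (s * K) ^+ 2 <= eta ^+ 2 * m%:R.

Let c1 := theta ^+ 4 / (1 - eta) * (1 + eta).
Let c2 := theta ^+ 4 / (1 - eta) * (2 * eta).
Variable delta : R.
Hypotheses (up : c1 * (1 + 2 * eta) + c2 <= 1 + delta)
           (low : c1 * (1 - delta) + c2 <= 1 - 2 * eta).

Definition restricted_isometry (w : {ffun 'I_m -> F}) := forall X : 'M[R]_n,
  frob X = 1 -> nuclear_class s k X ->
  `|\sum_i mxdot (b (w i)) X ^+ 2 - m%:R| <= delta * m%:R.

Lemma finite_restricted_isometry :
  \sum_(w : {ffun 'I_m -> F}) law p w * (~~ `[< restricted_isometry w >])%:R <=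
  2 * \sum_(j < J.+1) (2 * ((m.*2.+1 ^ M j)%:R * expR (- (eta * lam j / 2)))).
Proof.
have /andP[eta0 eta1] := eta01.
have theta0 : 0 < theta by rewrite /theta; lra.
pose A (w : {ffun 'I_m -> F}) X : R := \sum_i mxdot (b (w i)) X ^+ 2.
pose viol w X := [/\ frob X = 1, nuclear_class s k X & ~ `|A w X - m%:R| <= delta * m%:R].
have witness w : exists X, ~~ `[< restricted_isometry w >] -> viol w X.
  have [h|h] := pselect (restricted_isometry w); first by exists 0; move/asboolP.
  move/existsNP: h => [X /not_implyP[fX /not_implyP[nX hX]]].
  by exists X.
(* The violating matrix is chosen from [w] alone, so it is fixed when the ghost sample is drawn and
   Chebyshev for a single matrix suffices. The event [Q] below quantifies over all [X] instead,
   since exchanging pairs would destroy that choice. *)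
have [Xw hXw] := choice witness.
pose good w w' := `|A w' (Xw w) - m%:R| <= 2 * eta * m%:R.
pose cmp (w w' : {ffun 'I_m -> F}) X := A w X <= c1 * A w' X + c2 * m%:R.
pose Q (w : {ffun 'I_m -> F} * {ffun 'I_m -> F}) := `[< exists X, nuclear_class s k X /\ ~ (cmp w.1 w.2 X /\ cmp w.2 w.1 X) >].
have mp : 0 < m%:R :> R by rewrite ltr0n.
have c1p : 0 < c1 by rewrite /c1 !mulr_gt0 ?invr_gt0 ?exprn_gt0 //; lra.
apply: (@ghost_sample _ _ p m p0 p1 _ good Q).
- move=> w /hXw [fX nX _].
  set X := Xw w in fX nX.
  pose v f := mxdot (b f) X ^+ 2.
  have vK f : v f <= (2 * (s * K)) ^+ 2.
    rewrite /v -[leLHS]real_normK ?num_real // ler_pXn2r ?nnegrE ?mulr_ge0 ?(ltW s0) ?(ltW K0) //.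
    apply: (le_trans (nX _)); rewrite mulrCA ler_pM2l //.
    exact: schatten_le_op hn (ltW K0) (hb _).
  have ev := second_moment fX; rewrite -/v in ev.
  have em : 0 < eta * m%:R by rewrite mulr_gt0.
  (* The values of [v] are at most [4 * (s * K) ^+ 2] and their mean at most 2, so their second
     moment is at most [8 * (s * K) ^+ 2]; [m_large] turns Chebyshev's bound into 1/2. *)
  apply: le_trans (_ : m%:R * (\sum_f p f * v f ^+ 2) / (eta * m%:R) ^+ 2 <= _); last first.
    have h1 : \sum_f p f * v f ^+ 2 <= (2 * (s * K)) ^+ 2 * \sum_f p f * v f.
      rewrite mulr_sumr; apply: ler_sum => f _; rewrite [leRHS]mulrCA ler_wpM2l // expr2.
      by rewrite ler_wpM2r ?sqr_ge0.
    have h2 : \sum_f p f * v f <= 2 by move: ev; rewrite ler_norml => /andP[_]; lra.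
    have h3 : \sum_f p f * v f ^+ 2 <= 8 * (s * K) ^+ 2.
      apply: (le_trans h1); have := ler_wpM2l (sqr_ge0 (2 * (s * K))) h2.
      by rewrite exprMn; lra.
    rewrite ler_pdivrMr ?exprn_gt0 //.
    apply: (@le_trans _ _ (m%:R * (8 * (s * K) ^+ 2))); first by rewrite ler_pM2l.
    have := ler_wpM2l (ltW mp) m_large; rewrite exprMn !expr2; lra.
  apply: le_trans (law_chebyshev m p0 p1 (erefl (\sum_f p f * v f)) em).
  apply: ler_sum => w' _; rewrite ler_wpM2l ?law_ge0 // ler_nat.
  rewrite /good -ltNge; case: ltP => //= h; case: ltP => //= h'; exfalso.
  move: h; apply/negP; rewrite -leNgt.
  have -> : A w' (Xw w) - m%:R = (\sum_i v (w' i) - m%:R * \sum_f p f * v f) + m%:R * (\sum_f p f * v f - 1).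
    by rewrite /A /v; ring.
  apply: (le_trans (ler_normD _ _)); rewrite normrM (ger0_norm (ltW mp)).
  by have := ler_wpM2l (ltW mp) ev; move: h'; lra.
- move=> w w' /hXw [fX nX hX] hg; apply/asboolP; exists (Xw w); split=> // -[].
  rewrite /cmp /= => h1 h2; apply: hX.
  move: hg; rewrite /good ler_norml => /andP[g1 g2].
  rewrite ler_norml; apply/andP; split.
    have g3 : (1 - 2 * eta) * m%:R <= c1 * A w (Xw w) + c2 * m%:R by lra.
    have := ler_wpM2r (ltW mp) low.
    move=> l1; have : c1 * ((1 - delta) * m%:R) <= c1 * A w (Xw w) by lra.
    by rewrite ler_pM2l //; lra.
  have : A w' (Xw w) <= (1 + 2 * eta) * m%:R by lra.
  move/(ler_wpM2l (ltW c1p)) => h3.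
  have := ler_wpM2r (ltW mp) up; lra.
apply: symmetrization => // w.
pose b2 (i : 'I_m * bool) := b (if i.2 then w.1 i.1 else w.2 i.1).
have [bad hbad hcmp] := sign_comparison K0 s0 hn (fun i => hb _ : op_bound (b2 i) K) eta01 rho0 top lam hM.
apply: le_trans hbad; apply: ler_sum => sg _; rewrite ler_nat.
suff : Q (swap sg w) -> bad sg by case: (Q _) => // ->.
move=> /asboolP[X [nX hX]]; apply/negPn/negP => nb.
have [h1 h2] := hcmp _ _ nb nX; apply: hX.
have en1 : energy b2 sg X = A (swap sg w).1 X.
  by apply: eq_bigr => i _; rewrite /b2 ffunE.
have en2 : energy b2 (flip sg) X = A (swap sg w).2 X.
  by apply: eq_bigr => i _; rewrite /b2 !ffunE /=; case: (sg i).
rewrite en1 en2 in h1 h2.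
have c0 : 0 <= theta ^+ 4 / (1 - eta) * 2 by rewrite !mulr_ge0 ?invr_ge0 ?exprn_ge0 ?(ltW theta0) //; lra.
have := ler_wpM2l c0 hLam; rewrite -/theta in h1 h2.
rewrite /cmp /c1 /c2; move: h1 h2; rewrite -/Lam; move: (theta ^+ 4 / (1 - eta)) => c.
by rewrite -/theta => h1 h2 h3; split; lra.
Qed.

End FiniteRIP.

(** * Choice of the parameters *)

Section Tuning.
Variable R : realType.

(** Both losses are at most linear in [eta] with a coefficient below 20, which [delta] absorbs. *)
Lemma geom_constants (eta delta : R) : 0 < eta -> eta <= 10^-1 -> 40 * eta <= delta ->
  delta < 1 ->
  let c := (1 + eta) ^+ 4 / (1 - eta) in
  c * (1 + eta) * (1 + 2 * eta) + c * (2 * eta) <= 1 + delta /\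
  c * (1 + eta) * (1 - delta) + c * (2 * eta) <= 1 - 2 * eta.
Proof.
move=> e0 e1 ed d1 c.
have e2 : eta ^+ 2 <= eta / 10 by rewrite expr2; nra.
have e20 : 0 <= eta ^+ 2 := sqr_ge0 _.
have e3 : eta ^+ 3 <= eta ^+ 2 / 10 by rewrite exprSr; nra.
have e4 : eta ^+ 4 <= eta ^+ 2 / 10.
  have e30 : 0 <= eta ^+ 3 by rewrite exprn_ge0 // ltW.
  have : eta ^+ 4 <= eta ^+ 3 by rewrite exprSr; nra.
  lra.
have c0 : 0 < c by rewrite /c divr_gt0 ?exprn_gt0 //; lra.
have hc : c <= 1 + 8 * eta.
  rewrite /c ler_pdivrMr; last by lra.
  have -> : (1 + eta) ^+ 4 = 1 + 4 * eta + 6 * eta ^+ 2 + 4 * eta ^+ 3 + eta ^+ 4 by ring.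
  have -> : (1 + 8 * eta) * (1 - eta) = 1 + 7 * eta - 8 * eta ^+ 2 by ring.
  lra.
have hc1 : c * (1 + eta) <= 1 + 10 * eta.
  apply: (@le_trans _ _ ((1 + 8 * eta) * (1 + eta))); first by rewrite ler_pM2r //; lra.
  have -> : (1 + 8 * eta) * (1 + eta) = 1 + 9 * eta + 8 * eta ^+ 2 by ring.
  lra.
have hc2 : c * (2 * eta) <= 4 * eta.
  have : c <= 2 by lra.
  nra.
split.
  apply: (@le_trans _ _ ((1 + 10 * eta) * (1 + 2 * eta) + 4 * eta)).
    by rewrite lerD // ler_pM2r //; lra.
  have -> : (1 + 10 * eta) * (1 + 2 * eta) = 1 + 12 * eta + 20 * eta ^+ 2 by ring.
  lra.
apply: (@le_trans _ _ ((1 + 10 * eta) * (1 - delta) + 4 * eta)).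
  by rewrite lerD // ler_pM2r //; lra.
have : 0 <= eta * delta by rewrite mulr_ge0; lra.
lra.
Qed.

Lemma bernoulli_inequality (x : R) k : 0 <= x -> 1 + k%:R * x <= (1 + x) ^+ k.
Proof.
move=> x0; elim: k => [|k IH]; first by rewrite mul0r addr0 expr0.
rewrite exprS -natr1; have := ler_wpM2l (_ : 0 <= 1 + x) IH => /(_ (addr_ge0 ler01 x0)).
have : 0 <= k%:R * x * x by rewrite !mulr_ge0.
lra.
Qed.

Lemma ln_le_sqrt (u : R) : 0 < u -> ln u <= 2 * Num.sqrt u.
Proof.
move=> u0; have s0 : 0 < Num.sqrt u by rewrite sqrtr_gt0.
have -> : ln u = 2 * ln (Num.sqrt u).
  by rewrite -{1}(sqr_sqrtr (ltW u0)) lnXn // [RHS]mulr_natl.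
by rewrite ler_pM2l // ltW // ln_sublinear.
Qed.

Lemma ln2_ge_half : 2^-1 <= ln 2 :> R.
Proof.
have h : ln (1 + - 2^-1) <= - 2^-1 :> R by apply: le_ln1Dx; lra.
have e : 1 + - 2^-1 = 2^-1 :> R by field.
by rewrite e lnV ?posrE // in h; lra.
Qed.

Lemma up_log2_le_ln n : 1 <= ln n%:R :> R -> (1 < n)%N /\ (up_log 2 n)%:R <= 3 * ln n%:R :> R.
Proof.
move=> y1; have n1 : (1 < n)%N.
  rewrite ltnNge; apply/negP => h; have : ln n%:R <= 0 :> R by rewrite ln_le0 // lern1.
  lra.
split=> //; have := @up_log_gtn 2 n isT n1; set l := up_log 2 n => hl.
have h : ln ((2 ^ l.-1)%:R) <= ln n%:R :> R.
  by rewrite ler_ln ?posrE ?ltr0n ?expn_gt0 ?ler_nat ?(ltnW hl) // ltnW.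
rewrite natrX lnXn // -[ln _ *+ _]mulr_natl in h.
have hl1 : l%:R <= l.-1%:R + 1 :> R by rewrite natr1 ler_nat leqSpred.
have : l.-1%:R * 2^-1 <= l.-1%:R * ln 2 :> R by rewrite ler_wpM2l // ln2_ge_half.
lra.
Qed.

(* To be read with [L = r K^2] and [y = ln n]. *)
Lemma log_budget (C eta c0 y L m : R) : 0 < C -> 0 < eta -> 0 < L -> 1 <= y -> 1 <= m ->
  ln L <= 5 * y ->
  32 * C / eta + 64 * C ^+ 2 / eta ^+ 2 <= c0 -> c0 * L * y ^+ 7 < m ->
  C * y ^+ 2 * (1 + ln (2 * m + 1)) * L <= eta * m / 2.
Proof.
move=> C0 eta0 L0 y1 m1 hL hc0 hm; pose u := m / L.
have u0 : 0 < u by rewrite divr_gt0 //; lra.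
have mE : m = u * L by rewrite /u mulfVK // gt_eqF.
have huy : c0 * y ^+ 7 < u by rewrite /u ltr_pdivlMr // mulrAC.
have p1 : 0 < 32 * C / eta by rewrite !mulr_gt0 ?invr_gt0.
have p2 : 0 < 64 * C ^+ 2 / eta ^+ 2 by rewrite !mulr_gt0 ?invr_gt0 ?exprn_gt0.
have hu j : (j <= 7)%N -> c0 * y ^+ j <= u.
  move=> j7; apply: le_trans (ltW huy); rewrite ler_pM2l; last by lra.
  by rewrite ler_weXn2l.
(* [m] occurs on both sides of the goal. Writing [m = u * L], the part of the logarithm coming from
   [u] is bounded by its square root, which is of lower order than [u]. *)
have hln : ln (2 * m + 1) <= 7 * y + 2 * Num.sqrt u.
  have h1 : ln (2 * m + 1) <= ln (3 * (u * L)).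
    by rewrite -mE ler_ln ?posrE; lra.
  apply: (le_trans h1); have uL0 : 0 < u * L by rewrite mulr_gt0.
  rewrite [ln (3 * _)]lnM ?posrE // [ln (u * L)]lnM ?posrE //.
  have := ln_le_sqrt u0; have : ln (1 + 2) <= 2 :> R by apply: le_ln1Dx; lra.
  have -> : 1 + 2 = 3 :> R by ring.
  lra.
have su0 : 0 < Num.sqrt u by rewrite sqrtr_gt0.
have suE : Num.sqrt u ^+ 2 = u by rewrite sqr_sqrtr // ltW.
have part1 : 8 * C * y ^+ 3 <= eta * u / 4.
  have h3 : 32 * C / eta * y ^+ 3 <= u.
    apply: le_trans (hu 3%N isT); rewrite ler_wpM2r ?exprn_ge0 //; lra.
  have : eta * (32 * C / eta * y ^+ 3) <= eta * u by rewrite ler_pM2l.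
  have -> : eta * (32 * C / eta * y ^+ 3) = 32 * (C * y ^+ 3) by field; rewrite gt_eqF.
  lra.
have part2 : 2 * C * y ^+ 2 * Num.sqrt u <= eta * u / 4.
  have h4 : (8 * C / eta * y ^+ 2) ^+ 2 <= Num.sqrt u ^+ 2.
    rewrite suE; apply: le_trans (hu 4%N isT).
    have -> : (8 * C / eta * y ^+ 2) ^+ 2 = (64 * C ^+ 2 / eta ^+ 2) * y ^+ 4.
      by field; rewrite gt_eqF.
    by rewrite ler_wpM2r ?exprn_ge0 //; lra.
  rewrite ler_pXn2r ?nnegrE ?(ltW su0) // in h4; last first.
    by rewrite !mulr_ge0 ?invr_ge0 ?exprn_ge0 //; lra.
  have h5 : 8 * C * y ^+ 2 <= eta * Num.sqrt u.
    have := ler_wpM2l (ltW eta0) h4.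
    have -> // : eta * (8 * C / eta * y ^+ 2) = 8 * C * y ^+ 2 by field; rewrite gt_eqF.
  have := ler_wpM2r (ltW su0) h5.
  have -> : eta * Num.sqrt u * Num.sqrt u = eta * u by rewrite -mulrA -expr2 suE.
  lra.
have cy0 : 0 <= C * y ^+ 2 by rewrite mulr_ge0 ?exprn_ge0 //; lra.
have h6 : C * y ^+ 2 * (1 + ln (2 * m + 1)) <= eta * u / 2.
  have h7 : C * y ^+ 2 * (1 + ln (2 * m + 1)) <= C * y ^+ 2 * (8 * y + 2 * Num.sqrt u).
    by rewrite ler_wpM2l //; lra.
  apply: (le_trans h7).
  have -> : C * y ^+ 2 * (8 * y + 2 * Num.sqrt u) = 8 * C * y ^+ 3 + 2 * C * y ^+ 2 * Num.sqrt u by ring.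
  lra.
have := ler_wpM2r (ltW L0) h6; rewrite {3}mE; lra.
Qed.

(** The cone condition says by duality that the nuclear norm of [X] is at most [Num.sqrt r%:R],
    without reference to the exponent [k]. *)
Definition nuclear_isometry n m (F : finType) (b : F -> 'M[R]_n) (delta : R) (r : nat)
    (w : {ffun 'I_m -> F}) := forall X : 'M[R]_n, frob X = 1 ->
  (forall G c, 0 <= c -> op_bound G c -> mxdot G X <= Num.sqrt r%:R * c) ->
  `|\sum_i mxdot (b (w i)) X ^+ 2 - m%:R| <= delta * m%:R.

Lemma finite_nuclear_isometry (delta : R) : 0 < delta < 1 ->
  exists eta c0 : R, [/\ 0 < eta, eta < 1, 0 < c0 &
  exists N : nat, forall n : nat, (N <= n)%N ->
  forall (m r : nat) (K : R) (F : finType) (p : F -> R) (b : F -> 'M[R]_n),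
    (forall f, 0 <= p f) -> \sum_f p f = 1 ->
    (0 < r <= n)%N -> 0 < K -> K <= n%:R ^+ 2 ->
    (forall f, op_bound (b f) K) ->
    (forall X, frob X = 1 -> `|\sum_f p f * mxdot (b f) X ^+ 2 - 1| <= eta) ->
    c0 * r%:R * K ^+ 2 * ln n%:R ^+ 7 < m%:R ->
    \sum_(w : {ffun 'I_m -> F}) law p w * (~~ `[< nuclear_isometry b delta r w >])%:R
      <= (n%:R ^+ 2)^-1].
Proof.
move=> /andP[delta0 delta1].
pose eta := delta / 40.
have eta0 : 0 < eta by rewrite /eta; lra.
have eta1 : eta < 1 by rewrite /eta; lra.
have [] := @geom_constants eta delta; [exact: eta0|by rewrite /eta; lra|by rewrite /eta; lra|exact: delta1|].
have eta_delta : 40 * eta = delta by rewrite /eta; lra.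
clearbody eta; move=> up low.
pose theta := 1 + eta.
have theta1 : 1 < theta by rewrite /theta; lra.
(* [a] consecutive levels at least double the threshold, so the number of levels is [a] times a
   multiple of log n. *)
have [a a_gt0 ha] : exists2 a : nat, (0 < a)%N & 2 <= theta ^+ a.
  exists (Num.bound eta^-1); first by rewrite -(@ltr0n R); apply: le_lt_trans (archi_boundP _); rewrite invr_ge0 ltW.
  apply: le_trans (bernoulli_inequality _ (ltW eta0)).
  have : eta^-1 <= (Num.bound eta^-1)%:R by rewrite ltW // archi_boundP // invr_ge0 ltW.
  move/(ler_wpM2r (ltW eta0)); rewrite mulVf ?gt_eqF //; lra.
(* Product of the [14 * a * y] levels, the factor [2 / eta] in [lam], and the cost
   [208 * y / eta ^+ 2] per level, where 208 = 192 + 16. *)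
pose C := 28 * 208 * a%:R / eta ^+ 3.
have C0 : 0 < C by rewrite /C !mulr_gt0 ?ltr0n ?invr_gt0 ?exprn_gt0.
have CE : C = 28 * 208 * a%:R / eta ^+ 3 by [].
clearbody C.
(* The first two terms serve [log_budget], the last one Chebyshev for the ghost sample. *)
pose c0 := 32 * C / eta + 64 * C ^+ 2 / eta ^+ 2 + 16 / eta ^+ 2.
have q1 : 0 < 32 * C / eta by rewrite !mulr_gt0 ?invr_gt0.
have q2 : 0 < 64 * C ^+ 2 / eta ^+ 2 by rewrite !mulr_gt0 ?invr_gt0 ?exprn_gt0.
have q3 : 0 < 16 / eta ^+ 2 by rewrite !mulr_gt0 ?invr_gt0 ?exprn_gt0.
have c00 : 0 < c0 by rewrite /c0; lra.
exists eta, c0; split=> //.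
(* The summands ensure in turn [1 <= ln n], [1 / n <= eta / 2], and [4 * J.+1 <= n ^ 2] for the
   final union bound. *)
exists (Num.bound (expR 1 : R) + Num.bound (2 / eta) + 24 * a)%N.
move=> n hN m r K F p b p0 p1 /andP[r0 rn] K0 Kn hb hmom hm.
have nE : expR 1 <= n%:R :> R.
  apply: le_trans (ltW (archi_boundP (expR_ge0 1))) _; rewrite ler_nat.
  by apply: leq_trans hN; rewrite -addnA leq_addr.
have nEta : 2 / eta <= n%:R.
  apply: le_trans (ltW (archi_boundP _)) _; first by rewrite divr_ge0 // ltW.
  by rewrite ler_nat; apply: leq_trans hN; rewrite addnAC leq_addl.
have nA : (24 * a <= n)%N by apply: leq_trans hN; rewrite leq_addl.
pose y : R := ln n%:R.
have n0 : 0 < n%:R :> R by apply: lt_le_trans nE; exact: expR_gt0.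
have y1 : 1 <= y by rewrite -[leLHS]expRK ler_ln ?posrE ?expR_gt0.
have [n1 hl] := up_log2_le_ln y1.
set l := up_log 2 n in hl; rewrite -/y in hl.
have l0 : (0 < l)%N by rewrite up_log_gt0.
have nl : (n <= 2 ^ l)%N by exact: up_logP.
(* A double logarithm: [2 ^ k] lies between [l] and [2 * l], so the Schatten exponent [2 ^ k.+1] is
   of order log n. *)
pose k := up_log 2 l.
have lk : (l <= 2 ^ k)%N by exact: up_logP.
have kl : (2 ^ k <= 2 * l)%N.
  have [l1|l1] := ltnP 1 l; last by rewrite /k (_ : l = 1%N) ?up_log1 //; apply/eqP; rewrite eqn_leq l1.
  have := @up_log_gtn 2 l isT l1; rewrite -/k => h.
  have k0 : (0 < k)%N by rewrite up_log_gt0.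
  by rewrite -(prednK k0) expnS leq_mul2l /= ltnW.
have hn : (n <= 2 ^ (2 ^ k.+1))%N.
  apply: (leq_trans nl); rewrite leq_exp2l // (leq_trans lk) // leq_exp2l //.
pose s : R := Num.sqrt r%:R.
have s0 : 0 < s by rewrite sqrtr_gt0 ltr0n.
have s2 : s ^+ 2 = r%:R by rewrite sqr_sqrtr.
pose L : R := r%:R * K ^+ 2.
have L0 : 0 < L by rewrite mulr_gt0 ?ltr0n ?exprn_gt0.
have LE : L = r%:R * K ^+ 2 by [].
clearbody L.
pose T := 2 * (s * K).
have T0 : 0 < T by rewrite !mulr_gt0.
have T2 : T ^+ 2 = 4 * L by rewrite /T !exprMn s2 LE; ring.
(* Then [theta ^+ J] is at least 2 n^4, whereas [T] is at most 2 n^3 by [r <= n] and [K <= n ^ 2];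
   hence the bottom level [rho] is at most 1/n. *)
pose J := (a * (4 * l + 1))%N.
pose rho := T / theta ^+ J.
have tJ0 : 0 < theta ^+ J by rewrite exprn_gt0 // (lt_trans ltr01).
have rho0 : 0 < rho by rewrite divr_gt0.
have topE : level rho theta J = T by rewrite /level /rho mulfVK // gt_eqF.
have level_T j : (j <= J)%N -> level rho theta j ^+ 2 <= 4 * L.
  move=> jJ; rewrite -T2 -topE ler_pXn2r ?nnegrE ?(ltW (level_gt0 rho0 theta1 _)) //.
  exact: level_le.
have hrho : rho ^+ 2 <= eta / 2.
  have hTn : T <= 2 * n%:R ^+ 3.
    rewrite /T ler_pM2l // (exprSr n%:R 2) mulrC; apply: ler_pM; rewrite ?(ltW s0) ?(ltW K0) //.
    have n1' : 1 <= n%:R :> R by rewrite ler1n ltnW.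
    have -> : n%:R = Num.sqrt (n%:R ^+ 2) :> R by rewrite sqrtr_sqr ger0_norm.
    apply: ler_wsqrtr; apply: (@le_trans _ _ n%:R); first by rewrite ler_nat.
    by rewrite expr2 ler_peMr.
  have htJ : 2 * n%:R ^+ 4 <= theta ^+ J.
    rewrite /J exprM; apply: (@le_trans _ _ (2 ^+ (4 * l + 1))); last first.
      by rewrite ler_pXn2r ?nnegrE ?addn1 // exprn_ge0 // (le_trans ler01) // ltW.
    have -> : 2 ^+ (4 * l + 1) = 2 * (2 ^ l)%:R ^+ 4 :> R by rewrite natrX -exprM mulnC addn1 exprS.
    by rewrite ler_pM2l // ler_pXn2r ?nnegrE // ler_nat.
  have hr : rho <= n%:R^-1.
    rewrite /rho ler_pdivrMr //; apply: (le_trans hTn).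
    have := ler_wpM2l (_ : 0 <= n%:R^-1) htJ => /(_ _); rewrite invr_ge0 => /(_ (ltW n0)).
    have -> // : n%:R^-1 * (2 * n%:R ^+ 4) = 2 * n%:R ^+ 3 :> R by field; rewrite gt_eqF.
  have hr2 : n%:R^-1 <= eta / 2.
    by rewrite -[eta / 2]invrK lef_pV2 ?posrE ?invr_gt0 ?divr_gt0 // invf_div.
  apply: (@le_trans _ _ rho); last by apply: le_trans hr _.
  by rewrite expr2 ler_piMr ?(ltW rho0) // (le_trans hr) // (le_trans hr2) //; lra.
(* The mistake condition has left side at most [16 * l * L]; division by [eta ^+ 2 / 4] gives [Z],
   and [M j] is the least count it permits at level [j]. *)
pose Z := 64 * l%:R * L / eta ^+ 2.
have Z0 : 0 <= Z by rewrite /Z !mulr_ge0 ?invr_ge0 ?exprn_ge0 ?(ltW L0) ?(ltW eta0).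
pose M j := Num.truncn (Z / level rho theta j ^+ 2).
have lev2 j : 0 < level rho theta j ^+ 2 by rewrite exprn_gt0 // level_gt0.
have ZM j : Z < (M j).+1%:R * level rho theta j ^+ 2.
  by rewrite -ltr_pdivrMr // truncnS_gt.
have MZ j : (M j)%:R * level rho theta j ^+ 2 <= Z.
  by rewrite -ler_pdivlMr // truncn_le // divr_ge0 // ltW.
pose m1 : R := m%:R.
pose q := ln (2 * m1 + 1).
have m0 : (0 < m)%N.
  rewrite -(ltr0n R); apply: le_lt_trans hm.
  by rewrite !mulr_ge0 ?exprn_ge0 ?(ltW c00) ?(ltW K0) // (le_trans ler01).
have m1_1 : 1 <= m1 by rewrite /m1 ler1n.
have q0 : 0 <= q by rewrite ln_ge0 //; lra.
(* Makes the Chernoff exponent [M j * q + 4 * y]: the first part cancels the size of the family, the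
   second leaves n^-4 for each level. *)
pose lam j := 2 / eta * ((M j)%:R * q + 4 * y).
have hmL : c0 * L * y ^+ 7 < m1 by move: hm; rewrite LE !mulrA.
have lnL : ln L <= 5 * y.
  have hL : L <= n%:R ^+ 5.
    rewrite LE (exprS _ 4); apply: ler_pM; rewrite ?exprn_ge0 ?(ltW K0) ?ler_nat //.
    by rewrite (exprM n%:R 2 2) ler_pXn2r ?nnegrE ?(ltW K0) ?exprn_ge0.
  apply: (@le_trans _ _ (ln (n%:R ^+ 5))); first by rewrite ler_ln ?posrE ?exprn_gt0.
  by rewrite lnXn // -[ln _ *+ _]mulr_natl.
have Jnat : (J.+1 <= a * (4 * l + 2))%N.
  have -> : (4 * l + 2 = (4 * l + 1) + 1)%N by rewrite -addnA.
  by rewrite (mulnDr a _ 1) muln1 -(addn1 J) leq_add2l.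
have J1 : J.+1%:R <= 14 * a%:R * y :> R.
  have h : J.+1%:R <= a%:R * (4 * l%:R + 2) :> R.
    have -> : 4 * l%:R + 2 = (4 * l + 2)%:R :> R by rewrite natrD natrM.
    by rewrite -natrM ler_nat.
  apply: (le_trans h); rewrite -mulrA mulrCA ler_pM2l ?ltr0n //; lra.
have hLam : \sum_(j < J.+1) weight rho theta j * lam j <= eta * m1 / 2.
  apply: le_trans (log_budget C0 eta0 L0 y1 m1_1 lnL _ hmL); last by rewrite /c0; lra.
  have e1 j : (j <= J)%N -> weight rho theta j * lam j <= 2 / eta * (Z * q + 16 * L * y).
    move=> jJ; have e2 : 0 < 2 / eta by rewrite divr_gt0.
    apply: (@le_trans _ _ (level rho theta j ^+ 2 * lam j)).
      rewrite ler_wpM2r ?weight_le // /lam mulr_ge0 ?(ltW e2) // addr_ge0 ?mulr_ge0 //.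
      by rewrite (le_trans ler01).
    rewrite /lam mulrCA ler_pM2l //.
    by have := ler_wpM2r q0 (MZ j); have := ler_wpM2r (le_trans ler01 y1) (level_T _ jJ); lra.
  apply: (@le_trans _ _ (\sum_(j < J.+1) (2 / eta * (Z * q + 16 * L * y)))).
    by apply: ler_sum => j _; apply: e1; rewrite -ltnS.
  rewrite sumr_const card_ord -[_ *+ _]mulr_natl -/q.
  have hZ : Z * q + 16 * L * y <= 208 * y / eta ^+ 2 * (1 + q) * L.
    have i1 : 1 <= (eta ^+ 2)^-1.
      by rewrite invr_ge1 ?unitfE ?gt_eqF ?exprn_gt0 // exprn_ile1 // ltW.
    have i2 : Z <= 192 * y * L * (eta ^+ 2)^-1.
      rewrite /Z ler_pM2r ?invr_gt0 ?exprn_gt0 // ler_pM2r //; lra.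
    have i3 := ler_wpM2r q0 i2.
    have i4 : 16 * L * y <= 16 * L * y * (eta ^+ 2)^-1.
      by rewrite ler_peMr // !mulr_ge0 ?(ltW L0) // (le_trans ler01).
    have i5 : 0 <= 16 * L * y * (eta ^+ 2)^-1 * q.
      by rewrite !mulr_ge0 ?(ltW L0) ?invr_ge0 ?exprn_ge0 ?(ltW eta0) // (le_trans ler01).
    have i6 : 0 <= 192 * y * L * (eta ^+ 2)^-1.
      by rewrite !mulr_ge0 ?(ltW L0) ?invr_ge0 ?exprn_ge0 ?(ltW eta0) // (le_trans ler01).
    lra.
  apply: (@le_trans _ _ (14 * a%:R * y * (2 / eta * (208 * y / eta ^+ 2 * (1 + q) * L)))).
    apply: ler_pM => //.
      apply: mulr_ge0; first by rewrite divr_ge0 // ltW.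
      apply: addr_ge0; first exact: (mulr_ge0 Z0 q0).
      by rewrite !mulr_ge0 ?(ltW L0) // (le_trans ler01).
    by rewrite ler_pM2l // divr_gt0.
  rewrite le_eqVlt; apply/orP; left; apply/eqP; rewrite CE.
  by field; rewrite gt_eqF.
have fin : \sum_(w : {ffun 'I_m -> F}) law p w * (~~ `[< restricted_isometry b s k delta w >])%:R <=
    2 * \sum_(j < J.+1) (2 * ((m.*2.+1 ^ M j)%:R * expR (- (eta * lam j / 2)))).
  apply: (finite_restricted_isometry p0 p1 K0 s0 hn m0 hb (introT andP (conj eta0 eta1)) rho0 _ _ _ hmom _ up low).
  - by rewrite -/theta topE.
  - move=> j; rewrite -/theta; have := ZM j; rewrite s2.
    have k3 : (2 ^ k.+3)%:R <= 16 * l%:R :> R.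
      rewrite -natrM ler_nat; have -> : (2 ^ k.+3 = 8 * 2 ^ k)%N by rewrite !expnS !mulnA.
      by rewrite (_ : 16 * l = 8 * (2 * l))%N ?mulnA // -mulnA leq_mul2l.
    have : r%:R * (2 ^ k.+3)%:R * K ^+ 2 <= 16 * l%:R * L.
      have -> : r%:R * (2 ^ k.+3)%:R * K ^+ 2 = (2 ^ k.+3)%:R * L by rewrite LE; ring.
      by rewrite ler_pM2r.
    move=> h1 h2; apply: (le_lt_trans h1).
    have e4 : 0 < eta ^+ 2 / 4 by rewrite divr_gt0 ?exprn_gt0.
    have := h2; rewrite -(ltr_pM2r e4).
    have -> : Z * (eta ^+ 2 / 4) = 16 * l%:R * L by rewrite /Z; field; rewrite gt_eqF.
    by have -> : (M j).+1%:R * level rho theta j ^+ 2 * (eta ^+ 2 / 4) =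
       (M j).+1%:R * (eta * level rho theta j / 2) ^+ 2 by field.
  - have := ler_wpM2l (_ : 0 <= m1) hrho => /(_ (le_trans ler01 m1_1)).
    by rewrite -/theta -/m1; lra.
  - have -> : eta ^+ 2 * m%:R = eta ^+ 2 * m1 by [].
    have : 16 / eta ^+ 2 * L <= m1.
      apply: le_trans (ltW hmL); apply: (@le_trans _ _ (c0 * L)).
        by rewrite ler_pM2r // /c0; lra.
      rewrite ler_peMr ?(ltW (mulr_gt0 c00 L0)) //; exact: exprn_ege1.
    move/(ler_wpM2l (sqr_ge0 eta)).
    have -> : eta ^+ 2 * (16 / eta ^+ 2 * L) = 16 * (s * K) ^+ 2.
      by rewrite exprMn s2 -LE; field; rewrite gt_eqF.
    by [].
apply: (@le_trans _ _ (\sum_(w : {ffun 'I_m -> F}) law p w * (~~ `[< restricted_isometry b s k delta w >])%:R)).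
  apply: ler_sum => w _; rewrite ler_wpM2l ?law_ge0 // ler_nat.
  suff : `[< restricted_isometry b s k delta w >] -> `[< nuclear_isometry b delta r w >].
    by do 2!case: `[< _ >] => //; move=> /(_ isT).
  move=> /asboolP h; apply/asboolP => X fX hX; apply: h => // G.
  rewrite ler_norml lerNl; apply/andP; split.
    rewrite -mxdotNl; apply: hX (schatten_ge0 _ _) _ => v.
    by rewrite mulNmx norm2N; exact: op_bound_schatten.
  exact: hX (schatten_ge0 _ _) (op_bound_schatten _ _).
apply: (le_trans fin).
have term j : (m.*2.+1 ^ M j)%:R * expR (- (eta * lam j / 2)) = (n%:R ^+ 4)^-1 :> R.
  have -> : eta * lam j / 2 = (M j)%:R * q + 4 * y by rewrite /lam; field; rewrite gt_eqF.
  have q2m : (m.*2.+1)%:R = 2 * m1 + 1 :> R by rewrite -natr1 -muln2 natrM mulrC.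
  rewrite expRN expRD !expRM_natl /q lnK ?posrE; last by lra.
  rewrite /y lnK ?posrE // natrX q2m; field.
  by rewrite !gt_eqF //= ?exprn_gt0 //; lra.
under eq_bigr => j _ do rewrite term.
rewrite sumr_const card_ord -[_ *+ J.+1]mulr_natl.
have hJn : 4 * J.+1%:R <= n%:R ^+ 2 :> R.
  rewrite -natrX -natrM ler_nat.
  have ln : (l <= n)%N by rewrite up_log_min // ltnW // ltn_expl.
  apply: (@leq_trans (24 * a * n)); last by rewrite expnS expn1 leq_mul2r nA orbT.
  rewrite (_ : 24 * a * n = 4 * (a * (6 * n)))%N; last by rewrite [RHS]mulnCA [in RHS](mulnA 4) (mulnC 24 a) -mulnA.
  rewrite leq_mul2l /= (leq_trans Jnat) // leq_mul2l; apply/orP; right.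
  apply: (@leq_trans (4 * n + 2 * n)); last by rewrite -mulnDl.
  apply: leq_add; first by rewrite leq_mul2l.
  by apply: leq_pmulr; exact: ltnW.
have -> : 2 * (J.+1%:R * (2 * (n%:R ^+ 4)^-1)) = 4 * J.+1%:R / n%:R ^+ 4 :> R by field; rewrite gt_eqF.
rewrite ler_pdivrMr ?exprn_gt0 //.
by have -> : (n%:R ^+ 2)^-1 * n%:R ^+ 4 = n%:R ^+ 2 :> R by field; rewrite gt_eqF.
Qed.

End Tuning.

(** * Real spectral theorem *)

Section Spectral.
Variable R : realType.

(** Over the complex numbers [S] is Hermitian and so has a real eigenvalue. Being a root of the
    characteristic polynomial descends to the reals, where an eigenvector is then taken. *)
Lemma symmetric_eigenvector n (S : 'M[R]_n.+1) : S^T = S ->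
  exists (lam : R) (u : 'cV[R]_n.+1), S *m u = lam *: u /\ u^T *m u = 1%:M.
Proof.
move=> symS.
pose f := real_complex R.
pose Sc : 'M[R[i]]_n.+1 := map_mx f S.
have Sreal : Sc \is a realmx.
  by apply/mxOverP => i j; rewrite mxE; apply/complex_realP; exists (S i j).
have Ssym : Sc \is symmetricmx.
  apply/is_hermitianmxP; rewrite expr0 scale1r map_mx_id //.
  by rewrite /Sc map_trmx symS.
have herm := realsym_hermsym Ssym Sreal.
have := hermitian_spectral_diag_real herm => /mxOverP/(_ 0 0)/complex_realP[lam lamE].
have /orthomx_spectralP Seq := hermitian_normalmx herm.
have Punit := spectral_unit Sc.
have ev : eigenvalue Sc (f lam).
  apply/eigenvalueP; exists (row 0 (spectralmx Sc)).
    rewrite -row_mul {2}Seq !mulmxA mulmxV // mul1mx row_mul row_diag_mx.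
    by rewrite -scalemxAl -rowE lamE.
  apply/eqP => h; have := mulmxV Punit => /(congr1 (row 0)); rewrite row_mul h mul0mx row1.
  by move=> /matrixP/(_ 0 0)/eqP; rewrite !mxE !eqxx eq_sym oner_eq0.
have : eigenvalue S lam.
  by move: ev; rewrite !eigenvalue_root_char -(map_char_poly f) /= fmorph_root.
move=> /eigenvalueP[v vS v0].
have nv0 : 0 < norm2 v^T.
  rewrite lt_neqAle norm2_ge0 andbT eq_sym; apply: contra v0 => /eqP h.
  by rewrite -[v]trmxK (norm2_eq0 h) trmx0.
exists lam, ((norm2 v^T)^-1 *: v^T); split.
  rewrite -scalemxAr scalerA mulrC -scalerA; congr (_ *: _).
  by rewrite -[in LHS]symS -trmx_mul vS linearZ.
rewrite [((_ *: _)^T)%R]linearZ /= -scalemxAl -scalemxAr scalerA.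
apply/matrixP => i j; rewrite !ord1 !mxE eqxx mulr1n.
have := norm2_sqr v^T; rewrite /mxtrace big_ord1 mxE => <-.
by field; rewrite gt_eqF.
Qed.

(** [H] is the reflection in the hyperplane orthogonal to [u - e], which exchanges the unit vectors
    [u] and [e]. *)
Lemma householder n (u : 'cV[R]_n.+1) : u^T *m u = 1%:M ->
  exists2 H : 'M[R]_n.+1, H^T *m H = 1%:M & H *m delta_mx 0 0 = u.
Proof.
move=> u1; pose e : 'cV[R]_n.+1 := delta_mx 0 0.
have [->|ne] := eqVneq u e; first by exists 1%:M; rewrite ?trmx1 mul1mx.
pose w := u - e; pose a := (w^T *m w) 0 0.
have sc (M : 'M[R]_1) : M = (M 0 0)%:M by apply/matrixP => i j; rewrite !ord1 mxE.
have e1 : e^T *m e = 1%:M by rewrite trmx_delta mul_delta_mx; apply/matrixP => i j; rewrite !ord1 !mxE.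
pose t := (e^T *m u) 0 0.
have ut : u^T *m e = t%:M by rewrite [LHS]sc -[u^T *m e]trmxK trmx_mul trmxK mxE.
have eu : e^T *m u = t%:M by rewrite [LHS]sc.
have aE : a = 2 - 2 * t.
  rewrite /a /w [(u - e)^T]linearB mulmxBl !mulmxBr u1 ut eu e1 !mxE eqxx !mulr1n; ring.
have a0 : a != 0.
  have : 0 < norm2 w ^+ 2.
    rewrite exprn_gt0 // lt_neqAle norm2_ge0 andbT eq_sym.
    by apply: contra ne => /eqP h; rewrite -subr_eq0 -/w (norm2_eq0 h).
  by rewrite norm2_sqr /mxtrace big_ord1 => /gt_eqF ->.
have wtw : w^T *m w = a%:M by rewrite [LHS]sc.
pose H := 1%:M - (2 / a) *: (w *m w^T).
have HT : H^T = H by rewrite /H [(_ - _)^T]linearB [X in _ - X]linearZ /= trmx1 trmx_mul trmxK.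
exists H.
  rewrite HT /H mulmxBl mul1mx mulmxBr mulmx1 -scalemxAl -scalemxAr scalerA.
  rewrite mulmxA -(mulmxA w) wtw mul_mx_scalar -scalemxAl scalerA.
  have -> : 2 / a * (2 / a) * a = 2 / a + 2 / a by field.
  by rewrite scalerDl opprB addrK subrK.
rewrite /H mulmxBl mul1mx -scalemxAl -mulmxA -/e.
have -> : w^T *m e = (t - 1)%:M by rewrite /w [(u - e)^T]linearB mulmxBl ut e1 -raddfB.
rewrite mul_mx_scalar scalerA (_ : 2 / a * (t - 1) = -1) ?scaleN1r ?opprK; last first.
  by rewrite (_ : t - 1 = - a / 2); [field|rewrite aE; field].
by rewrite /w addrC subrK.
Qed.

(** Deflation: conjugating by a reflection that sends the first basis vector to an eigenvector
    splits off a 1 by 1 block. *)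
Theorem symmetric_spectral n (S : 'M[R]_n) : S^T = S ->
  exists (V : 'M[R]_n) (d : 'rV[R]_n), V^T *m V = 1%:M /\ S = V *m diag_mx d *m V^T.
Proof.
elim: n S => [|n IH] S symS.
  by exists 1%:M, 0; split; apply/matrixP => -[].
have [lam [u [Su uu]]] := symmetric_eigenvector symS.
have [H HH He] := householder uu.
have HH' : H *m H^T = 1%:M by apply: mulmx1C.
pose S1 : 'M[R]_(1 + n) := H^T *m S *m H.
have symS1 : S1^T = S1 by rewrite /S1 !trmx_mul trmxK symS !mulmxA.
have col0 : S1 *m (delta_mx 0 0 : 'cV_n.+1) = lam *: (delta_mx 0 0 : 'cV_n.+1).
  by rewrite /S1 -!mulmxA He Su -scalemxAr -He mulmxA HH mul1mx.
have S1i0 i : S1 i 0 = lam * (i == 0)%:R.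
  by have := congr1 (fun M : 'cV_n.+1 => M i 0) col0; rewrite -colE !mxE eqxx andbT.
have SE : S = H *m S1 *m H^T by rewrite /S1 !mulmxA HH' mul1mx -mulmxA HH' mulmx1.
clearbody S1; clear col0.
pose S2 : 'M[R]_n := drsubmx S1.
have symS2 : S2^T = S2 by rewrite /S2 trmx_drsub symS1.
have [V [d [VV VS]]] := IH _ symS2.
have S1E : S1 = block_mx lam%:M 0 0 S2.
  rewrite -[S1]submxK -/S2; congr (block_mx _ _ _ _).
  - apply/matrixP => i j; rewrite !ord1 !mxE !lshift0 S1i0 eqxx mulr1n mulr1 //.
  - apply/matrixP => i j; rewrite !ord1 -symS1 !mxE lshift0 S1i0 -val_eqE /=.
    by rewrite mulr0.
  - apply/matrixP => i j; rewrite !ord1 !mxE lshift0 S1i0 -val_eqE /=.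
    by rewrite mulr0.
pose V1 : 'M[R]_(1 + n) := block_mx 1%:M 0 0 V.
pose d1 : 'rV[R]_(1 + n) := row_mx lam%:M d.
have V1V1 : V1^T *m V1 = 1%:M.
  rewrite /V1 tr_block_mx !trmx0 trmx1 mulmx_block !mulmx0 !mul0mx !addr0 !add0r mulmx1 VV.
  by rewrite -scalar_mx_block.
have VdV : S1 = V1 *m diag_mx d1 *m V1^T.
  rewrite S1E /V1 /d1 tr_block_mx !trmx0 trmx1 diag_mx_row !mulmx_block.
  rewrite !mulmx0 !mul0mx !addr0 !add0r !mul1mx !mulmx1 -VS !mul0mx.
  by congr block_mx; apply/matrixP => i j; rewrite !ord1 !mxE.
exists (H *m V1), d1; split.
  by rewrite trmx_mul -mulmxA (mulmxA H^T) HH mul1mx.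
by rewrite SE VdV trmx_mul !mulmxA.
Qed.

End Spectral.

(** * Nuclear norm duality *)

Section Nuclear.
Variables (R : realType) (n : nat).
Implicit Types A G H P W X : 'M[R]_n.

Lemma sum_count_mem (u s : seq R) (f : R -> R) : uniq u -> {subset s <= u} ->
  \sum_(x <- u) (count_mem x s)%:R * f x = \sum_(y <- s) f y.
Proof.
move=> uu; elim: s => [|y s IH] sub.
  by rewrite big_nil big1 // => x _; rewrite mul0r.
rewrite big_cons -IH => [|z zs]; last by apply: sub; rewrite inE zs orbT.
under eq_bigr => x _ do rewrite /= natrD mulrDl.
rewrite big_split /=; congr (_ + _).
rewrite (bigD1_seq y) ?sub ?mem_head //= eqxx mul1r big1 ?addr0 // => x /negbTE xy.
by rewrite eq_sym xy mul0r.
Qed.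

(** The characteristic polynomial is that of the diagonal factor, so its roots with multiplicities
    are the entries of [d]. *)
Lemma nucnorm_spectral A (V : 'M[R]_n) (d : 'rV[R]_n) : V^T *m V = 1%:M ->
  A^T *m A = V *m diag_mx d *m V^T -> nucnorm A = \sum_k Num.sqrt (d 0 k).
Proof.
move=> VV AE.
pose s := [seq d 0 k | k <- enum 'I_n].
have pE : char_poly (A^T *m A) = \prod_(y <- s) ('X - y%:P).
  have -> : char_poly (A^T *m A) = char_poly (diag_mx d).
    rewrite AE /char_poly /char_poly_mx !map_mxM.
    pose Vp := map_mx polyC V; pose Vpt := map_mx polyC V^T.
    have VVp : Vp *m Vpt = 1%:M by rewrite -map_mxM (mulmx1C VV) map_mx1.
    have -> : 'X%:M - Vp *m map_mx polyC (diag_mx d) *m Vpt =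
        Vp *m ('X%:M - map_mx polyC (diag_mx d)) *m Vpt.
      by rewrite mulmxBr mulmxBl mul_mx_scalar -scalemxAl VVp scalemx1.
    rewrite !det_mulmx mulrAC -det_mulmx VVp det1 mul1r //.
  rewrite char_poly_trig ?diag_mx_is_trig // /s big_map big_enum /=.
  by apply: eq_bigr => k _; rewrite mxE eqxx mulr1n.
have p0 : char_poly (A^T *m A) != 0 by rewrite monic_neq0 // char_poly_monic.
rewrite /nucnorm.
transitivity (\sum_(x <- rootsR (char_poly (A^T *m A))) (count_mem x s)%:R * Num.sqrt x).
  by apply: eq_bigr => x _; rewrite pE mu_prod_XsubC.
rewrite sum_count_mem; first by rewrite /s big_map big_enum.
  exact: uniq_roots.
move=> y ys; have := roots_on_rootsR p0 y; rewrite in_itv /= => <-.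
by rewrite pE root_prod_XsubC.
Qed.

Section SpectralCalculus.
Variables (V : 'M[R]_n) (d : 'rV[R]_n).
Hypothesis VV : V^T *m V = 1%:M.

Definition specfun (g : R -> R) : 'M[R]_n := V *m diag_mx (\row_k g (d 0 k)) *m V^T.

Lemma specfunM g h : specfun g *m specfun h = specfun (fun x => g x * h x).
Proof.
rewrite /specfun !mulmxA -(mulmxA _ V^T V) VV mulmx1 -(mulmxA V) mulmx_diag.
by congr (_ *m diag_mx _ *m _); apply/rowP => k; rewrite !mxE.
Qed.

Lemma specfunT g : (specfun g)^T = specfun g.
Proof. by rewrite /specfun !trmx_mul trmxK tr_diag_mx mulmxA. Qed.

Lemma tr_specfun g : \tr (specfun g) = \sum_k g (d 0 k).
Proof.
rewrite /specfun mxtrace_mulC mulmxA VV mul1mx mxtrace_diag.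
by apply: eq_bigr => k _; rewrite mxE.
Qed.

Lemma eq_specfun g h : (forall k, g (d 0 k) = h (d 0 k)) -> specfun g = specfun h.
Proof.
move=> gh; rewrite /specfun; congr (_ *m diag_mx _ *m _); apply/rowP => k.
by rewrite !mxE gh.
Qed.

End SpectralCalculus.

Definition orthoproj P := P^T = P /\ P *m P = P.

Lemma norm2_proj P (v : 'cV[R]_n) : orthoproj P -> norm2 (P *m v) <= norm2 v.
Proof.
move=> [PT PP]; have := norm2_ge0 (P *m v); rewrite le_eqVlt => /orP[/eqP <-|lt0].
  exact: norm2_ge0.
rewrite -(ler_pM2r lt0) -expr2 norm2_sqr trmx_mul PT.
rewrite -!mulmxA (mulmxA P) PP; exact: norm2_Cauchy.
Qed.

Lemma orthoprojC P : orthoproj P -> orthoproj (1%:M - P).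
Proof.
move=> [PT PP]; split; first by rewrite [LHS]linearB /= trmx1 PT.
by rewrite mulmxBl mul1mx mulmxBr mulmx1 PP subrr subr0.
Qed.

Lemma norm2_projD P (v : 'cV[R]_n) : orthoproj P ->
  norm2 v ^+ 2 = norm2 (P *m v) ^+ 2 + norm2 ((1%:M - P) *m v) ^+ 2.
Proof.
move=> hP; have [PT PP] := hP; have [QT QQ] := orthoprojC hP.
rewrite !norm2_sqr !trmx_mul PT QT -!mulmxA (mulmxA P) PP (mulmxA (1%:M - P)) QQ.
by rewrite -linearD -mulmxDr -mulmxDl addrC subrK mul1mx.
Qed.

Lemma spectral_diagE A (V : 'M[R]_n) (d : 'rV[R]_n) k : V^T *m V = 1%:M ->
  A^T *m A = V *m diag_mx d *m V^T -> d 0 k = norm2 (A *m (V *m delta_mx k 0)) ^+ 2.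
Proof.
move=> VV AE.
rewrite norm2_sqr !trmx_mul -!mulmxA (mulmxA A^T) AE -!mulmxA.
rewrite (mulmxA V^T V) VV mul1mx (mulmxA V^T V) VV mul1mx trmx_delta -rowE -colE.
by rewrite /mxtrace big_ord1 !mxE eqxx mulr1n.
Qed.

(* The partial isometry of the polar decomposition, with its initial and final projections. *)
Lemma polar A : exists W PU PV : 'M[R]_n,
  [/\ op_bound W 1, mxdot W A = nucnorm A,
      [/\ orthoproj PU, PU *m A = A, PU *m W = W & (\rank PU <= \rank A)%N] &
      [/\ orthoproj PV, A *m PV = A, W *m PV = W & (\rank PV <= \rank A)%N]].
Proof.
have [V [d [VV AE]]] : exists (V : 'M[R]_n) (d : 'rV[R]_n),
    V^T *m V = 1%:M /\ A^T *m A = V *m diag_mx d *m V^T.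
  by apply: symmetric_spectral; rewrite trmx_mul trmxK.
pose F := specfun V d.
have FE : A^T *m A = F id.
  by rewrite AE; congr (_ *m diag_mx _ *m _); apply/rowP => k; rewrite mxE.
have d0 k : 0 <= d 0 k by rewrite (spectral_diagE k VV AE) sqr_ge0.
(* As the inverse of 0 is 0, [F g] is the pseudo-inverse of the root of [A^T *m A], and [F e] is the
   projection onto its range. *)
pose g (x : R) := (Num.sqrt x)^-1; pose e (x : R) : R := (x != 0)%:R.
have sx k : Num.sqrt (d 0 k) ^+ 2 = d 0 k by rewrite sqr_sqrtr.
have s0 k : (Num.sqrt (d 0 k) == 0) = (d 0 k == 0) by rewrite sqrtr_eq0 le_eqVlt ltNge d0 orbF.
have gx k : g (d 0 k) * d 0 k = Num.sqrt (d 0 k).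
  have [h|h] := eqVneq (d 0 k) 0; first by rewrite h mulr0 sqrtr0.
  by rewrite /g -{2}sx expr2 mulKf // s0.
have ggx k : g (d 0 k) * d 0 k * g (d 0 k) = e (d 0 k).
  rewrite gx /g /e; have [h|h] := eqVneq (d 0 k) 0; first by rewrite h sqrtr0 mul0r.
  by rewrite mulfV // s0.
have eg k : e (d 0 k) * g (d 0 k) = g (d 0 k).
  rewrite /e; have [h|_] := eqVneq (d 0 k) 0; last by rewrite mul1r.
  by rewrite h /g sqrtr0 invr0 mulr0.
have ex k : e (d 0 k) * d 0 k = d 0 k.
  by rewrite /e; have [->|_] := eqVneq (d 0 k) 0; rewrite ?mulr0 ?mul1r.
have ie k : (d 0 k)^-1 * d 0 k = e (d 0 k).
  by rewrite /e; have [->|h] := eqVneq (d 0 k) 0; rewrite ?mulr0 ?mulVf.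
have ee k : e (d 0 k) * e (d 0 k) = e (d 0 k).
  by rewrite /e; case: eqVneq; rewrite ?mulr0 ?mulr1.
have FT h : (F h)^T = F h by exact: specfunT.
have FM h h' : F h *m F h' = F (fun x => h x * h' x) by exact: specfunM.
have Feq h h' : (forall k, h (d 0 k) = h' (d 0 k)) -> F h = F h' by exact: eq_specfun.
have Ftr h : \tr (F h) = \sum_k h (d 0 k) by exact: tr_specfun.
clearbody F.
pose PV := F e; pose W := A *m F g; pose PU := A *m F (fun x => x^-1) *m A^T.
have hPV : orthoproj PV.
  by split; rewrite /PV // FM; apply: Feq => k; rewrite ee.
have APV : A *m PV = A.
  suff : A *m (1%:M - PV) = 0 by rewrite mulmxBr mulmx1 => /eqP; rewrite subr_eq0 => /eqP.
  apply: frob_eq0; apply/eqP; rewrite -sqrf_eq0 frob_sqr /mxdot trmx_mul -mulmxA (mulmxA A^T) FE.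
  have -> : F id *m (1%:M - PV) = 0.
    have -> : PV = F e by [].
    rewrite mulmxBr mulmx1 FM; apply/eqP; rewrite subr_eq0; apply/eqP; apply: Feq => k.
    by rewrite mulrC ex.
  by rewrite mulmx0 linear0.
have WTW : W^T *m W = PV.
  rewrite /W trmx_mul FT -mulmxA (mulmxA A^T) FE !FM; apply: Feq => k.
  by rewrite mulrA ggx.
exists W, PU, PV; split.
- move=> v; rewrite mul1r.
  suff -> : norm2 (W *m v) = norm2 (PV *m v) by exact: norm2_proj.
  apply: (@pexpIrn _ 2); rewrite ?nnegrE ?norm2_ge0 //.
  have [PT PP] := hPV; move: WTW PT PP; move: (W) (PV) => W1 P1 WTW PT PP.
  by rewrite !norm2_sqr !trmx_mul PT -!mulmxA (mulmxA W1^T) WTW (mulmxA P1) PP.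
- rewrite (nucnorm_spectral VV AE) /mxdot /W trmx_mul FT -mulmxA FE FM Ftr.
  by apply: eq_bigr => k _; exact: gx.
- split.
  + split; first by rewrite /PU !trmx_mul trmxK FT mulmxA.
    rewrite /PU -!mulmxA (mulmxA A^T) FE (mulmxA (F id)) FM (mulmxA (F _) (F _)) FM.
    congr (_ *m (_ *m _)); apply: Feq => k.
    by rewrite mulrA ie; rewrite /e; have [->|h] := eqVneq (d 0 k) 0; rewrite ?invr0 ?mul0r ?mul1r.
  + rewrite /PU -!mulmxA FE FM -[RHS]APV; congr (_ *m _); apply: Feq => k; exact: ie.
  + rewrite /PU /W -!mulmxA (mulmxA A^T) FE !FM; congr (_ *m _); apply: Feq => k.
    by rewrite mulrA ie eg.
  + by rewrite /PU -mulmxA mxrankM_maxl.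
- split=> //.
  + by rewrite /W -mulmxA FM; congr (_ *m _); apply: Feq => k; rewrite mulrC eg.
  + have -> : PV = F (fun x => x^-1) *m A^T *m A.
      by rewrite -mulmxA FE FM; apply: Feq => k; rewrite ie.
    exact: mxrankM_maxr.
Qed.

(** In an eigenbasis v_k of [A^T *m A] the inner product is the sum of <G v_k, A v_k>, and |A v_k|
    is the k-th singular value. *)
Lemma nucnorm_dual G A c : op_bound G c -> mxdot G A <= c * nucnorm A.
Proof.
move=> hG.
have [V [d [VV AE]]] : exists (V : 'M[R]_n) (d : 'rV[R]_n),
    V^T *m V = 1%:M /\ A^T *m A = V *m diag_mx d *m V^T.
  by apply: symmetric_spectral; rewrite trmx_mul trmxK.
rewrite (nucnorm_spectral VV AE) mulr_sumr.
have -> : mxdot G A = mxdot (G *m V) (A *m V).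
  rewrite /mxdot trmx_mul [RHS]mxtrace_mulC -mulmxA (mulmxA V) (mulmx1C VV) mul1mx.
  exact: mxtrace_mulC.
rewrite mxdotE exchange_big; apply: ler_sum => k _ /=.
apply: (@le_trans _ _ (norm2 (col k (G *m V)) * norm2 (col k (A *m V)))).
  apply: le_trans (norm2_Cauchy _ _).
  by rewrite /mxtrace big_ord1 mxE; apply: ler_sum => i _; rewrite !mxE.
have cn : norm2 (col k (A *m V)) = Num.sqrt (d 0 k).
  apply: (@pexpIrn _ 2); rewrite ?nnegrE ?norm2_ge0 ?sqrtr_ge0 // (spectral_diagE k VV AE).
  by rewrite sqrtr_sqr ger0_norm ?norm2_ge0 // colE -mulmxA.
rewrite cn ler_wpM2r ?sqrtr_ge0 // colE -mulmxA; apply: (le_trans (hG _)).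
suff -> : norm2 (V *m (delta_mx k 0 : 'cV[R]_n)) = 1 by rewrite mulr1.
apply: (@pexpIrn _ 2); rewrite ?nnegrE ?norm2_ge0 // norm2_sqr trmx_mul -mulmxA (mulmxA V^T) VV mul1mx.
by rewrite -norm2_sqr norm2_delta.
Qed.

(** In a full-rank factorization P = C R, idempotence forces R C = 1. *)
Lemma tr_idempotent P : P *m P = P -> \tr P = (\rank P)%:R.
Proof.
move=> PP; have RC : row_base P *m col_base P = 1%:M.
  apply: (row_full_inj (col_base_full P)); apply: (row_free_inj (row_base_free P)).
  by rewrite /= mulmx1 -(mulmxA (col_base P)) -(mulmxA (row_base P)) mulmx_base (mulmxA _ _ P) mulmx_base.
by rewrite -{1}(mulmx_base P) mxtrace_mulC RC mxtrace1.
Qed.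

Lemma mxdot_proj P G X : P^T = P -> mxdot (P *m G) X = mxdot G (P *m X).
Proof. by move=> PT; rewrite /mxdot trmx_mul PT mulmxA. Qed.

Lemma mxdot_projr P G X : P^T = P -> mxdot (G *m P) X = mxdot G (X *m P).
Proof. by move=> PT; rewrite /mxdot trmx_mul PT -mulmxA mxtrace_mulC mulmxA. Qed.

(** Only the projection of [G] to the column space of [X] matters, and its squared Frobenius norm is
    at most [c ^+ 2] times the rank. *)
Lemma mxdot_rank G X c : 0 <= c -> op_bound G c ->
  mxdot G X <= Num.sqrt (\rank X)%:R * c * frob X.
Proof.
move=> c0 hG; have [W [PU [PV [_ _ [[PT PP] PX _ rk] _]]]] := polar X.
rewrite -{1}PX -mxdot_proj //; apply: (le_trans (mxdot_le_frob _ _)).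
rewrite ler_wpM2r ?frob_ge0 // -(@ler_pXn2r _ 2) ?nnegrE ?mulr_ge0 ?sqrtr_ge0 ?frob_ge0 //.
rewrite exprMn [X in _ <= X * _]sqr_sqrtr // -frobT trmx_mul PT frob_sqr_col.
apply: (@le_trans _ _ (\sum_j c ^+ 2 * norm2 (col j PU) ^+ 2)).
  apply: ler_sum => j _; rewrite -exprMn ler_pXn2r ?nnegrE ?mulr_ge0 ?norm2_ge0 //.
  by rewrite !colE -mulmxA; exact: op_boundT.
rewrite -mulr_sumr -frob_sqr_col frob_sqr /mxdot PT PP tr_idempotent // mulrC.
by rewrite ler_wpM2r ?sqr_ge0 // ler_nat.
Qed.

(* [Hc] is the part of [H] orthogonal to the row and column spaces of [S]; the dual
   certificates of [S] and [Hc] act on orthogonal spaces and so add up. *)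
Lemma nuclear_cone (S H : 'M[R]_n) r G c : (\rank S <= r)%N ->
  nucnorm (S + H) <= nucnorm S -> 0 <= c -> op_bound G c ->
  mxdot G H <= Num.sqrt (8 * r)%:R * c * frob H.
Proof.
move=> rS hnuc c0 hG.
have [W [PU [PV [W1 WS [hPU PUS PUW rU] [hPV SPV WPV rV]]]]] := polar S.
have [PUT PUU] := hPU; have [PVT PVV] := hPV.
have hQU := orthoprojC hPU; have hQV := orthoprojC hPV.
set QU := 1%:M - PU in hQU; set QV := 1%:M - PV in hQV.
have [QUT QUU] := hQU; have [QVT QVV] := hQV.
have QUP : QU *m PU = 0 by rewrite mulmxBl mul1mx PUU subrr.
have PVQ : PV *m QV = 0 by rewrite mulmxBr mulmx1 PVV subrr.
have PUQ : PU *m QU = 0 by rewrite mulmxBr mulmx1 PUU subrr.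
have QUE : QU = 1%:M - PU by []; have QVE : QV = 1%:M - PV by [].
clearbody QU QV.
pose Hc := QU *m H *m QV; pose H0 := H - Hc.
have [W' [_ [_ [W'1 W'H _ _]]]] := polar Hc.
pose Wc := QU *m W' *m QV.
have opW : op_bound (W + Wc) 1.
  move=> v; rewrite mul1r -(@ler_pXn2r _ 2) ?nnegrE ?norm2_ge0 //.
  rewrite (norm2_projD _ hPU) (norm2_projD v hPV) -QUE -QVE.
  have -> : PU *m ((W + Wc) *m v) = W *m (PV *m v).
    by rewrite !mulmxA mulmxDr PUW /Wc !mulmxA PUQ !mul0mx addr0 WPV.
  have -> : QU *m ((W + Wc) *m v) = QU *m (W' *m (QV *m v)).
    by rewrite !mulmxA mulmxDr -{1}PUW mulmxA QUP mul0mx add0r /Wc !mulmxA QUU.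
  rewrite lerD // ler_pXn2r ?nnegrE ?norm2_ge0 //.
    by have := W1 (PV *m v); rewrite mul1r.
  apply: (le_trans (norm2_proj _ hQU)).
  by have := W'1 (QV *m v); rewrite mul1r.
have move_c A B : mxdot (QU *m A *m QV) B = mxdot A (QU *m B *m QV).
  by rewrite mxdot_projr // mxdot_proj // mulmxA.
have WcS : mxdot Wc S = 0.
  rewrite move_c; have -> : QU *m S = 0 by rewrite -PUS mulmxA QUP mul0mx.
  by rewrite mul0mx mxdot0r.
have WcH : mxdot Wc H = nucnorm Hc by rewrite move_c -W'H.
have WHc : mxdot W Hc = 0.
  rewrite -move_c; have -> : QU *m W = 0 by rewrite -PUW mulmxA QUP mul0mx.
  by rewrite mul0mx mxdot0l.
have HE : H = H0 + Hc by rewrite /H0 subrK.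
have QH0 : QU *m H0 *m QV = 0.
  rewrite /H0 mulmxBr mulmxBl /Hc !mulmxA QUU -(mulmxA _ QV QV) QVV subrr //.
have rk0 : (\rank H0 <= 2 * r)%N.
  have -> : H0 = PU *m H + QU *m H *m PV.
    rewrite /H0 /Hc QVE mulmxBr mulmx1 opprB addrCA addrC; congr (_ + _).
    by rewrite QUE mulmxBl mul1mx opprB addrC subrK.
  apply: (leq_trans (mxrank_add _ _)); rewrite mul2n -addnn leq_add //.
    by apply: leq_trans rS; apply: leq_trans rU; exact: mxrankM_maxl.
  by apply: leq_trans rS; apply: leq_trans rV; exact: mxrankM_maxr.
have orth : mxdot H0 Hc = 0 by rewrite -move_c QH0 mxdot0l.
clearbody H0 Hc.
have fr0 : frob H0 <= frob H.
  rewrite -(@ler_pXn2r _ 2) ?nnegrE ?frob_ge0 // [X in _ <= frob X ^+ 2]HE !frob_sqr.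
  rewrite mxdotDl !mxdotDr orth (mxdotC Hc H0) orth addr0 add0r lerDl; exact: mxdot_ge0.
have bound0 G' c' : 0 <= c' -> op_bound G' c' -> mxdot G' H0 <= Num.sqrt (2 * r)%:R * c' * frob H.
  move=> c'0 hG'; apply: (le_trans (mxdot_rank _ c'0 hG')).
  apply: ler_pM; rewrite ?mulr_ge0 ?sqrtr_ge0 ?frob_ge0 // ler_wpM2r //.
  by rewrite ler_wsqrtr // ler_nat.
(* Testing [S + H] against [W + Wc] gives nucnorm S + <W, H0> + nucnorm Hc, which minimality bounds
   by nucnorm S. *)
have nHc : nucnorm Hc <= Num.sqrt (2 * r)%:R * frob H.
  have opNW : op_bound (- W) 1 by move=> v; rewrite mulNmx norm2N.
  have := bound0 _ _ ler01 opNW; rewrite mulr1 mxdotNl => h.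
  have := nucnorm_dual (S + H) opW; rewrite mul1r !mxdotDl !mxdotDr WS WcS WcH.
  have : mxdot W H = mxdot W H0 by rewrite {1}HE mxdotDr WHc addr0.
  move: hnuc h; lra.
rewrite {1}HE mxdotDr.
have h1 := bound0 _ _ c0 hG; have h2 := nucnorm_dual Hc hG.
have h3 := ler_wpM2l c0 nHc.
(* [H0], of rank at most [2 * r], and [Hc] each contribute one term [Num.sqrt (2 * r)%:R]; this is
   the origin of 8. *)
have -> : Num.sqrt (8 * r)%:R = 2 * Num.sqrt (2 * r)%:R :> R.
  have -> : (8 * r = 2 ^ 2 * (2 * r))%N by rewrite mulnA.
  by rewrite natrM sqrtrM // natrX sqrtr_sqr ger0_norm.
lra.
Qed.

End Nuclear.

(** * Reduction to a finite sample space *)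

Lemma ae_nonempty (R : realType) (d : measure_display) (T : measurableType d)
    (P : probability T R) (Q : T -> Prop) : {ae P, forall w, Q w} -> exists w, Q w.
Proof.
move=> [N [mN PN QN]]; apply: contrapT => nQ.
have NT : N = setT by apply/seteqP; split=> // w _; apply: QN => /= h; apply: nQ; exists w.
by move: PN; rewrite NT probability_setT => /eqP; rewrite onee_eq0.
Qed.

Section FiniteValued.
Context (R : realType) (d : measure_display) (T : measurableType d).
Variables (P : probability T R) (F : finType) (Y : T -> F).
Hypothesis mY : forall f, measurable (Y @^-1` [set f]).

Definition cell_mass (f : F) : R := fine (P (Y @^-1` [set f])).

Lemma cell_mass_ge0 f : 0 <= cell_mass f.
Proof. by rewrite fine_ge0. Qed.

Lemma simple_integrable (s : F -> R) :
  P.-integrable setT (fun w => (s (Y w))%:E) /\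
  (\int[P]_w (s (Y w))%:E = (\sum_f cell_mass f * s f)%:E)%E.
Proof.
have sE : (fun w => (s (Y w))%:E) =
    (fun w => \sum_(f : F) ((s f)%:E * (\1_(Y @^-1` [set f]) w)%:E))%E.
  apply/funext => w; rewrite (bigD1 (Y w)) //= big1 ?adde0.
    by rewrite indicE mem_set // mule1.
  move=> f fY; rewrite indicE memNset ?mule0 // => /= h.
  by rewrite h eqxx in fY.
have int1 f : P.-integrable setT (fun w => (s f)%:E * (\1_(Y @^-1` [set f]) w)%:E)%E.
  by apply: integrableZl => //; exact: integrable_indic.
rewrite sE; split; first by apply: integrable_sum.
rewrite integral_sum //= -sumEFin; apply: eq_bigr => f _.
rewrite integralZl //; last exact: integrable_indic.
rewrite integral_indic // setIT mulrC EFinM /cell_mass fineK //.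
exact: fin_num_measure.
Qed.

Lemma cell_mass_sum1 : \sum_f cell_mass f = 1.
Proof.
have [_] := simple_integrable (fun=> 1).
have -> : (\int[P]_w (1%R)%:E = 1%:E)%E.
  by rewrite -[RHS]mule1 -(probability_setT P) -integral_cst.
by move=> [->]; apply: eq_bigr => f _; rewrite mulr1.
Qed.

Lemma simple_prob (s : pred F) :
  measurable (Y @^-1` [set f | s f]) /\
  fine (P (Y @^-1` [set f | s f])) = \sum_f cell_mass f * (s f)%:R.
Proof.
have [is_ sE] := simple_integrable (fun f => (s f)%:R).
have ms : measurable_fun setT (fun w => (s (Y w))%:R : R).
  by apply/measurable_EFinP; exact: measurable_int is_.
have SE : Y @^-1` [set f | s f] = (fun w => (s (Y w))%:R : R) @^-1` [set 1].
  apply/seteqP; split=> w /=; first by move=> ->.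
  by case: (s (Y w)) => // /eqP; rewrite eq_sym oner_eq0.
have mS : measurable (Y @^-1` [set f | s f]).
  by rewrite SE -[X in measurable X]setTI; exact: ms.
split=> //; apply: EFin_inj; rewrite -sE fineK; last exact: fin_num_measure.
rewrite -[X in P X]setIT -integral_indic //; apply: eq_integral => w _.
rewrite indicE; congr (_%:R%:E); congr nat_of_bool.
by apply/idP/idP => [|h]; [move/set_mem|exact/mem_set].
Qed.

Lemma simple_approx (g : T -> R) (s : F -> R) (e : R) : measurable_fun setT g ->
  {ae P, forall w, `|g w - s (Y w)| <= e} ->
  `|fine ('E_P[g]) - \sum_f cell_mass f * s f| <= e.
Proof.
move=> mg hae; have [is_ sE] := simple_integrable s.
have e0 : 0 <= e.
  have [w] := ae_nonempty hae.
  exact/le_trans/normr_ge0.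
pose u w := g w - s (Y w).
have ms : measurable_fun setT (fun w => s (Y w)).
  by apply/measurable_EFinP; exact: measurable_int is_.
have mu : measurable_fun setT u by apply: measurable_funB.
have ule : (\int[P]_w `|(u w)%:E| <= e%:E)%E.
  rewrite -[leRHS]mule1 -(probability_setT P) -integral_cst //.
  apply: ae_ge0_le_integral => //.
  - by apply: measurableT_comp => //; exact/measurable_EFinP.
  - have [N [mN N0 hN]] := hae; exists N; split=> // w hw; apply: hN => /= h.
    by apply: hw => _; rewrite lee_fin.
(* Integrability of [g] is deduced rather than assumed: [g] is a simple function plus the almost
   surely bounded [u]. *)
have iu : P.-integrable setT (EFin \o u).
  apply/integrableP; split; first exact/measurable_EFinP.
  by apply: le_lt_trans ule _; rewrite ltry.
have gE : ('E_P[g] = \int[P]_w (u w)%:E + (\sum_f cell_mass f * s f)%:E)%E.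
  rewrite unlock -sE -integralD //.
  by apply: eq_integral => w _; rewrite -EFinD subrK.
have fu : (\int[P]_w (u w)%:E)%E \is a fin_num by exact: integrable_fin_num.
rewrite gE fineD //= addrK -lee_fin -abse_EFin fineK //.
apply: le_trans ule; apply: le_abse_integral => //; exact/measurable_EFinP.
Qed.

End FiniteValued.

(** * Norm and entry bounds for matrices *)

Section MatrixBounds.
Variables (R : realType) (n : nat).
Implicit Types A X Y : 'M[R]_n.

Lemma norm2Z m (a : R) (v : 'cV[R]_m) : norm2 (a *: v) = `|a| * norm2 v.
Proof.
rewrite /norm2; under eq_bigr => i _ do rewrite mxE exprMn.
by rewrite -mulr_sumr sqrtrM ?sqr_ge0 // sqrtr_sqr.
Qed.

Lemma norm2_0 m : norm2 (0 : 'cV[R]_m) = 0.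
Proof. by rewrite -(scale0r 0) norm2Z normr0 mul0r. Qed.

Lemma norm2D m (u v : 'cV[R]_m) : norm2 (u + v) <= norm2 u + norm2 v.
Proof.
rewrite -(@ler_pXn2r _ 2) ?nnegrE ?addr_ge0 ?norm2_ge0 //.
rewrite sqrrD !norm2_sqr [(u + v)^T]linearD mulmxDl !mulmxDr !mxtraceD.
by have := norm2_Cauchy u v; have := norm2_Cauchy v u; lra.
Qed.

Lemma op_bound_spec_norm A c : spec_norm A <= c -> op_bound A c.
Proof.
move=> hc v; have := norm2_ge0 v; rewrite le_eqVlt => /orP[/eqP v0|v0].
  by rewrite (norm2_eq0 (esym v0)) mulmx0 norm2_0 mulr0.
rewrite -ler_pdivrMr //; apply: le_trans hc.
have -> : norm2 (A *m v) / norm2 v = norm2 (A *m ((norm2 v)^-1 *: v)).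
  by rewrite -scalemxAr norm2Z ger0_norm ?invr_ge0 ?norm2_ge0 // mulrC.
apply: ub_le_sup; last first.
  exists ((norm2 v)^-1 *: v) => //=; rewrite norm2Z ger0_norm ?invr_ge0 ?norm2_ge0 //.
  by rewrite mulVf ?gt_eqF.
exists (frob A) => _ [u /= hu <-]; apply: (le_trans (norm2_mulmx_frob _ _)).
by rewrite ler_piMr ?frob_ge0.
Qed.

Lemma entry_le_norm2 m (v : 'cV[R]_m) i : `|v i 0| <= norm2 v.
Proof.
rewrite -sqrtr_sqr; apply: ler_wsqrtr; rewrite (bigD1 i) //= lerDl.
by apply: sumr_ge0 => k _; exact: sqr_ge0.
Qed.

Lemma entry_op_bound A c a b : op_bound A c -> `|A a b| <= c.
Proof.
move=> /(_ (delta_mx b 0)); rewrite norm2_delta mulr1 -colE; apply: le_trans.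
by have := entry_le_norm2 (col b A) a; rewrite mxE.
Qed.

Lemma frob_entries A c : 0 <= c -> (forall a b, `|A a b| <= c) -> frob A <= n%:R * c.
Proof.
move=> c0 hA; rewrite -(@ler_pXn2r _ 2) ?nnegrE ?mulr_ge0 ?frob_ge0 //.
rewrite frob_sqr mxdotE.
have -> : (n%:R * c) ^+ 2 = \sum_(i < n) \sum_(j < n) c ^+ 2.
  under eq_bigr => i _ do rewrite sumr_const card_ord -[_ *+ _]mulr_natl.
  by rewrite sumr_const card_ord -[RHS]mulr_natl; ring.
apply: ler_sum => i _; apply: ler_sum => j _; rewrite -expr2 -[leLHS]real_normK ?num_real //.
by rewrite ler_pXn2r ?nnegrE.
Qed.

Lemma mxdot_abs A X : `|mxdot A X| <= frob A * frob X.
Proof.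
by rewrite ler_norml mxdot_le_frob andbT lerNl -mxdotNl -(frobN A) mxdot_le_frob.
Qed.

(** Some bound [C] has to be supplied, because [sup] of an unbounded set is a default value and
    controls nothing. *)
Lemma opnormF_le (L : 'M[R]_n -> 'M[R]_n) (C : R) X :
  (forall Y, frob Y <= 1 -> frob (L Y) <= C) -> frob X <= 1 -> frob (L X) <= opnormF L.
Proof.
move=> hC hX; apply: ub_le_sup; last by exists X.
by exists C => _ [Y /= hY <-]; exact: hC.
Qed.

End MatrixBounds.

(** * Rounding of matrix entries to a grid *)

Section Quantization.
Variables (R : realType) (n L : nat) (K h : R).
Hypotheses (h0 : 0 < h) (KL : 2 * K < L%:R * h).
Notation cell := {ffun 'I_n * 'I_n * 'I_L -> bool}.

(** A unary code: each entry is recorded through its comparisons with [L] grid points, so codes form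
    a finite type and each cell is cut out by half-lines. *)
Definition quant (A : 'M[R]_n) : cell :=
  [ffun x : 'I_n * 'I_n * 'I_L => - K + (x.2)%:R * h <= A x.1.1 x.1.2].

Lemma quant_close (A A' : 'M[R]_n) a b : op_bound A K -> op_bound A' K ->
  quant A = quant A' -> `|A a b - A' a b| <= h.
Proof.
suff half (B B' : 'M[R]_n) : op_bound B K -> op_bound B' K -> quant B = quant B' ->
    B a b - B' a b <= h.
  by move=> hA hA' e; rewrite ler_norml half // andbT lerNl opprB half.
move=> hB hB' e; rewrite leNgt; apply/negP => lt_h.
have := entry_op_bound a b hB; rewrite ler_norml => /andP[b1 b2].
have := entry_op_bound a b hB'; rewrite ler_norml => /andP[b1' _].
pose j := Num.truncn ((B a b + K) / h).
have q0 : 0 <= (B a b + K) / h by rewrite divr_ge0 ?(ltW h0) //; lra.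
have j1 : j%:R * h <= B a b + K by rewrite -ler_pdivlMr // truncn_le.
have j2 : B a b + K < j.+1%:R * h by rewrite -ltr_pdivrMr // truncnS_gt.
have jL : (j < L)%N.
  rewrite -(ltr_nat R) -(ltr_pM2r h0); apply: le_lt_trans KL; lra.
have := congr1 (fun f : cell => f (a, b, Ordinal jL)) e; rewrite !ffunE /=.
have -> : - K + j%:R * h <= B a b by lra.
move/esym; rewrite -natr1 in j2; lra.
Qed.

Lemma quant_measurable f : mx_measurable (quant @^-1` [set f]).
Proof.
rewrite /mx_measurable; set G := \bigcup_(ij in _) _.
have -> : quant @^-1` [set f] = \bigcap_(x in [set: 'I_n * 'I_n * 'I_L])
    ((fun M : 'M[R]_n => M x.1.1 x.1.2) @^-1` [set z | (- K + (x.2)%:R * h <= z) = f x]).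
  apply/seteqP; split=> A /=; first by move=> <- x _ /=; rewrite ffunE.
  by move=> hA; apply/ffunP => x; rewrite ffunE; exact: hA.
have sI (A B : set 'M[R]_n) : <<s G >> A -> <<s G >> B -> <<s G >> (A `&` B).
  move=> sA sB; rewrite -[A `&` B]setCK setCI -bigcup2E -setTD.
  apply: sigma_algebraCD; apply: sigma_algebra_bigcup => -[|[|i]] /=.
  - by rewrite -setTD; exact: sigma_algebraCD.
  - by rewrite -setTD; exact: sigma_algebraCD.
  - exact: sigma_algebra0.
have sT : <<s G >> setT by rewrite -[X in <<s _ >> X]setD0; exact: (sigma_algebraCD (@sigma_algebra0 _ setT G)).
have -> : [set: 'I_n * 'I_n * 'I_L] = [set` enum {: 'I_n * 'I_n * 'I_L}].
  by apply/seteqP; split=> x //= _; rewrite mem_enum.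
rewrite bigcap_seq; apply: big_ind => // x _.
apply: sub_sigma_algebra; exists x.1 => //.
exists [set z | (- K + (x.2)%:R * h <= z) = f x] => //.
case: (f x).
  have -> : [set z | (- K + (x.2)%:R * h <= z) = true] = `[- K + (x.2)%:R * h, +oo[%classic.
    by apply/seteqP; split => z /=; rewrite in_itv /= andbT.
  exact: measurable_itv.
have -> : [set z | (- K + (x.2)%:R * h <= z) = false] = `]-oo, - K + (x.2)%:R * h[%classic.
  by apply/seteqP; split => z /=; rewrite in_itv /= ltNge; [move=> ->|move/negbTE].
exact: measurable_itv.
Qed.

(** Representatives are bounded matrices taken inside the cells, so the bound [K] is kept without
    loss; a cell that no bounded matrix meets gets 0. *)
Lemma quant_rep : 0 <= K -> exists rep : cell -> 'M[R]_n,
  (forall f, op_bound (rep f) K) /\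
  (forall A, op_bound A K -> quant (rep (quant A)) = quant A).
Proof.
move=> K0.
have ex f : exists B : 'M[R]_n, op_bound B K /\ (forall A, op_bound A K -> quant A = f -> quant B = f).
  have [[A [hA fA]]|none] := pselect (exists A, op_bound A K /\ quant A = f).
    by exists A.
  exists 0; split; last by move=> A hA fA; exfalso; apply: none; exists A.
  by move=> v; rewrite mul0mx norm2_0 mulr_ge0 ?norm2_ge0.
have [rep hrep] := choice ex; exists rep; split=> [f|A hA]; first exact: (hrep f).1.
exact: (hrep (quant A)).2 hA (erefl _).
Qed.

End Quantization.

Section RandomMatrix.
Context (R : realType) (d : measure_display) (T : measurableType d).
Variables (n : nat) (B : T -> 'M[R]_n).
Hypothesis mB : random_mx B.

Lemma measurable_entry a b : measurable_fun setT (fun w => B w a b).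
Proof.
move=> _ S mS; rewrite setTI; apply: (mB (A := (fun M : 'M[R]_n => M a b) @^-1` S)).
by apply: sub_sigma_algebra; exists (a, b) => //; exists S.
Qed.

Lemma measurable_mxdot X : measurable_fun setT (fun w => mxdot (B w) X).
Proof.
have -> : (fun w => mxdot (B w) X) = (fun w => \sum_i \sum_j B w i j * X i j).
  by apply/funext => w; rewrite mxdotE.
apply: measurable_sum => i; apply: measurable_sum => j; apply: measurable_funM.
  exact: measurable_entry.
exact: measurable_cst.
Qed.

End RandomMatrix.

(** * Second moments of the rounded matrices *)

Section SecondMoment.
Context (R : realType) (d : measure_display) (T : measurableType d).
Variables (P : probability T R) (n L : nat) (K h : R).
Hypotheses (K0 : 0 <= K) (h0 : 0 < h) (KL : 2 * K < L%:R * h).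
Variable rep : {ffun 'I_n * 'I_n * 'I_L -> bool} -> 'M[R]_n.
Hypothesis rep_op : forall f, op_bound (rep f) K.
Hypothesis repK : forall A, op_bound A K -> quant L K h (rep (quant L K h A)) = quant L K h A.

Lemma rep_mxdot f X : `|mxdot (rep f) X| <= n%:R * K * frob X.
Proof.
apply: (le_trans (mxdot_abs _ _)); rewrite ler_wpM2r ?frob_ge0 //.
by apply: frob_entries => // a b; exact: entry_op_bound.
Qed.

Lemma rep_close A X : op_bound A K ->
  `|mxdot A X - mxdot (rep (quant L K h A)) X| <= n%:R * h * frob X.
Proof.
move=> hA; rewrite -mxdotBl; apply: (le_trans (mxdot_abs _ _)); rewrite ler_wpM2r ?frob_ge0 //.
apply: frob_entries => [|a b]; first exact: ltW.
by rewrite mxE [X in _ + X]mxE; apply: (quant_close h0 KL) => //; rewrite repK.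
Qed.

Lemma rep_close_sqr A X : op_bound A K -> frob X = 1 ->
  `|mxdot A X ^+ 2 - mxdot (rep (quant L K h A)) X ^+ 2| <= 2 * n%:R ^+ 2 * K * h.
Proof.
move=> hA fX; have h1 := rep_close X hA; have h2 := rep_mxdot (quant L K h A) X.
have h3 : `|mxdot A X| <= n%:R * K * frob X.
  apply: (le_trans (mxdot_abs _ _)); rewrite ler_wpM2r ?frob_ge0 //.
  by apply: frob_entries => // a b; exact: entry_op_bound.
rewrite fX !mulr1 in h1 h2 h3; rewrite subr_sqr normrM.
have h4 := le_trans (ler_normD (mxdot A X) (mxdot (rep (quant L K h A)) X)) (lerD h3 h2).
have := ler_pM (normr_ge0 _) (normr_ge0 _) h1 h4.
by move=> h5; apply: (le_trans h5); rewrite le_eqVlt; apply/orP; left; apply/eqP; ring.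
Qed.

Variable B : T -> 'M[R]_n.
Hypotheses (mB : random_mx B) (aeB : {ae P, forall w, spec_norm (B w) <= K}).

Let Y w := quant L K h (B w).

Lemma quant_measurable_preimage f : measurable (Y @^-1` [set f]).
Proof. by apply: (mB (A := quant L K h @^-1` [set f])); exact: quant_measurable. Qed.

Lemma EBstarB_approx X a b : frob X <= 1 ->
  `|EBstarB P B X a b - \sum_f cell_mass P Y f * (mxdot (rep f) X * rep f a b)| <= 2 * n%:R * K * h.
Proof.
move=> fX; rewrite mxE; apply: (simple_approx quant_measurable_preimage).
  apply: measurable_funM; first exact: measurable_mxdot.
  exact: measurable_entry.
have [N [mN N0 hN]] := aeB; exists N; split=> // w hw; apply: hN => /= hs; apply: hw.
have hA := op_bound_spec_norm hs.
have f0 := frob_ge0 X.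
have n0 : 0 <= n%:R :> R by [].
have h1 : `|mxdot (B w) X - mxdot (rep (Y w)) X| <= n%:R * h.
  apply: (le_trans (rep_close X hA)); rewrite ler_piMr ?mulr_ge0 ?(ltW h0) //.
have h2 : `|mxdot (rep (Y w)) X| <= n%:R * K.
  apply: (le_trans (rep_mxdot _ X)); rewrite ler_piMr ?mulr_ge0 //.
have h3 := entry_op_bound a b hA.
have h4 : `|B w a b - rep (Y w) a b| <= h.
  by apply: (quant_close h0 KL) => //; rewrite repK.
rewrite /=; have -> : mxdot (B w) X * B w a b - mxdot (rep (Y w)) X * rep (Y w) a b =
  (mxdot (B w) X - mxdot (rep (Y w)) X) * B w a b +
  mxdot (rep (Y w)) X * (B w a b - rep (Y w) a b) by ring.
apply: (le_trans (ler_normD _ _)); rewrite !normrM.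
have h5 := ler_pM (normr_ge0 _) (normr_ge0 _) h1 h3.
have h6 := ler_pM (normr_ge0 _) (normr_ge0 _) h2 h4.
lra.
Qed.

Lemma finite_second_moment (g : R) X : opnormF (fun X => EBstarB P B X - X) <= g ->
  frob X = 1 ->
  `|\sum_f cell_mass P Y f * mxdot (rep f) X ^+ 2 - 1| <= g + 2 * n%:R ^+ 3 * K * h.
Proof.
move=> hop fX.
pose S Z : 'M[R]_n := \matrix_(a, b) \sum_f cell_mass P Y f * (mxdot (rep f) Z * rep f a b).
have p1 := cell_mass_sum1 P quant_measurable_preimage; have p0 := cell_mass_ge0 P Y.
have e0 : 0 <= 2 * n%:R * K * h by rewrite !mulr_ge0 // ltW.
(* A crude bound, needed only for the supremum in [opnormF] to be genuine. *)
have bdd Z : frob Z <= 1 -> frob (EBstarB P B Z - Z) <= n%:R * (2 * n%:R * K * h + n%:R * K * K) + 1.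
  move=> fZ; apply: (le_trans (frobD _ _)); rewrite frobN lerD //.
  apply: frob_entries => [|a b]; first by rewrite addr_ge0 // !mulr_ge0.
  have := EBstarB_approx a b fZ; set s := \sum_f _ => h1.
  have h2 : `|s| <= n%:R * K * K.
    apply: (le_trans (ler_norm_sum _ _ _)).
    apply: (@le_trans _ _ (\sum_f cell_mass P Y f * (n%:R * K * K))); last by rewrite -mulr_suml p1 mul1r.
    apply: ler_sum => f _; rewrite normrM ger0_norm // ler_wpM2l // normrM.
    apply: ler_pM => //; last exact: entry_op_bound.
    by apply: (le_trans (rep_mxdot _ _)); rewrite ler_piMr ?mulr_ge0.
  have -> : EBstarB P B Z a b = (EBstarB P B Z a b - s) + s by rewrite subrK.
  by apply: (le_trans (ler_normD _ _)); rewrite lerD.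
have h1 : frob (EBstarB P B X - X) <= g.
  by apply: le_trans hop; apply: (opnormF_le (L := fun X => EBstarB P B X - X)) bdd _; rewrite fX.
have h2 : `|mxdot (EBstarB P B X - X) X| <= g.
  by apply: (le_trans (mxdot_abs _ _)); rewrite fX mulr1.
have SE : mxdot (S X) X = \sum_f cell_mass P Y f * mxdot (rep f) X ^+ 2.
  rewrite mxdotE.
  under eq_bigr => a _ do under eq_bigr => b _ do rewrite mxE mulr_suml.
  under eq_bigr => a _ do rewrite exchange_big.
  rewrite exchange_big /=; apply: eq_bigr => f _.
  rewrite expr2 [X in _ = _ * (_ * X)]mxdotE !mulr_sumr; apply: eq_bigr => a _.
  by rewrite !mulr_sumr; apply: eq_bigr => b _; ring.
have h3 : `|mxdot (S X - EBstarB P B X) X| <= n%:R * (2 * n%:R * K * h).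
  apply: (le_trans (mxdot_abs _ _)); rewrite fX mulr1; apply: frob_entries => // a b.
  have -> : (S X - EBstarB P B X) a b =
      \sum_f cell_mass P Y f * (mxdot (rep f) X * rep f a b) - EBstarB P B X a b by rewrite !mxE.
  by rewrite distrC; apply: EBstarB_approx; rewrite fX.
rewrite -SE.
have -> : mxdot (S X) X - 1 = mxdot (S X - EBstarB P B X) X + mxdot (EBstarB P B X - X) X.
  by rewrite !mxdotBl -[mxdot X X]frob_sqr fX expr1n; ring.
apply: (le_trans (ler_normD _ _)); rewrite addrC lerD // (le_trans h3) //.
have n23 : n%:R ^+ 2 <= n%:R ^+ 3 :> R.
  by rewrite -!natrX ler_nat; case: (n) => // k; rewrite leq_pexp2l.
have := ler_wpM2r (_ : 0 <= 2 * K * h) n23 => /(_ _); rewrite !mulr_ge0 ?(ltW h0) // => /(_ isT).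
by rewrite expr2; lra.
Qed.

End SecondMoment.

(** * Deterministic consequences of the isometry on the cone *)

Section Recovery.
Variables (R : realType) (n m r : nat) (b : 'I_m -> 'M[R]_n) (delta : R).
Hypotheses (delta01 : 0 < delta < 1) (m0 : (0 < m)%N).
Hypothesis iso : forall X : 'M[R]_n, frob X = 1 ->
  (forall G c, 0 <= c -> op_bound G c -> mxdot G X <= Num.sqrt (minn (8 * r) n)%:R * c) ->
  `|\sum_i mxdot (b i) X ^+ 2 - m%:R| <= delta * m%:R.

Lemma norm2_meas X : norm2 (meas b X) ^+ 2 = \sum_i mxdot (b i) X ^+ 2.
Proof.
rewrite sqr_sqrtr; last by apply: sumr_ge0 => i _; exact: sqr_ge0.
by apply: eq_bigr => i _; rewrite mxE.
Qed.

Lemma cone_isometry X :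
  (forall G c, 0 <= c -> op_bound G c -> mxdot G X <= Num.sqrt (8 * r)%:R * c * frob X) ->
  `|m%:R^-1 * norm2 (meas b X) ^+ 2 - frob X ^+ 2| <= delta * frob X ^+ 2.
Proof.
move=> hX; have mp : 0 < m%:R :> R by rewrite ltr0n.
have := frob_ge0 X; rewrite le_eqVlt => /orP[/eqP f0|f0].
  rewrite norm2_meas (frob_eq0 (esym f0)) frob0 expr0n !mulr0 subr0.
  by rewrite big1 ?mulr0 ?normr0 // => i _; rewrite mxdot0r expr0n.
pose Z := (frob X)^-1 *: X.
have fi : 0 <= (frob X)^-1 by rewrite invr_ge0 ltW.
have fZ : frob Z = 1 by rewrite frobZ ger0_norm // mulVf // gt_eqF.
have XE : X = frob X *: Z by rewrite scalerA mulfV ?scale1r // gt_eqF.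
(* The parameter is capped at [n], as the probabilistic bound requires; above [n] the cone condition
   holds for every matrix, its rank being at most [n]. *)
have hZ G c : 0 <= c -> op_bound G c -> mxdot G Z <= Num.sqrt (minn (8 * r) n)%:R * c.
  move=> c0 hG; rewrite mxdotZr mulrC ler_pdivrMr //; case: (leqP (8 * r) n) => hrn.
    exact: hX.
  apply: (le_trans (mxdot_rank X c0 hG)).
  rewrite ler_wpM2r ?(ltW f0) // ler_wpM2r // ler_wsqrtr // ler_nat.
  exact: rank_leq_row.
have := iso fZ hZ.
have -> : norm2 (meas b X) ^+ 2 = frob X ^+ 2 * \sum_i mxdot (b i) Z ^+ 2.
  rewrite norm2_meas mulr_sumr; apply: eq_bigr => i _.
  by rewrite {1}XE mxdotZr exprMn.
set s := \sum_i _ => hs.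
have -> : m%:R^-1 * (frob X ^+ 2 * s) - frob X ^+ 2 = frob X ^+ 2 / m%:R * (s - m%:R).
  by field; rewrite gt_eqF.
rewrite normrM ger0_norm; last by rewrite divr_ge0 ?sqr_ge0.
have := ler_wpM2l (_ : 0 <= frob X ^+ 2 / m%:R) hs => /(_ (divr_ge0 (sqr_ge0 _) (ltW mp))).
have -> // : frob X ^+ 2 / m%:R * (delta * m%:R) = delta * frob X ^+ 2.
by field; rewrite gt_eqF.
Qed.

Lemma rank_isometry X : (\rank X <= r)%N ->
  `|m%:R^-1 * norm2 (meas b X) ^+ 2 - frob X ^+ 2| <= delta * frob X ^+ 2.
Proof.
move=> rX; apply: cone_isometry => G c c0 hG; apply: (le_trans (mxdot_rank X c0 hG)).
rewrite ler_wpM2r ?frob_ge0 // ler_wpM2r // ler_wsqrtr // ler_nat (leq_trans rX) //.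
exact: leq_pmull.
Qed.

Lemma nuclear_recovery (y : 'cV[R]_m) (eps : R) (S Shat : 'M[R]_n) :
  (\rank S <= r)%N -> norm2 (y - meas b S) <= eps -> norm2 (y - meas b Shat) <= eps ->
  nucnorm Shat <= nucnorm S ->
  frob (Shat - S) <= 2 / Num.sqrt (1 - delta) * eps / Num.sqrt m%:R.
Proof.
move=> rS hS hShat hnuc; have /andP[d0 d1] := delta01.
have mp : 0 < m%:R :> R by rewrite ltr0n.
set H := Shat - S.
have SH : Shat = S + H by rewrite /H addrC subrK.
have hn : nucnorm (S + H) <= nucnorm S by rewrite -SH.
have cone := cone_isometry (fun G c c0 hG => nuclear_cone rS hn c0 hG).
have mH : norm2 (meas b H) <= 2 * eps.
  have -> : meas b H = (y - meas b S) + - (y - meas b Shat).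
    by apply/colP => i; rewrite !mxE /H mxdotBr; ring.
  by apply: (le_trans (norm2D _ _)); rewrite norm2N; lra.
have eps0 : 0 <= eps by apply: le_trans hS; exact: norm2_ge0.
have mH2 : norm2 (meas b H) ^+ 2 <= (2 * eps) ^+ 2.
  by rewrite ler_pXn2r ?nnegrE ?norm2_ge0 ?mulr_ge0.
have key : (1 - delta) * frob H ^+ 2 <= m%:R^-1 * (2 * eps) ^+ 2.
  have : m%:R^-1 * norm2 (meas b H) ^+ 2 <= m%:R^-1 * (2 * eps) ^+ 2.
    by rewrite ler_pM2l ?invr_gt0.
  by move: cone; rewrite ler_norml => /andP[]; lra.
have d1' : 0 < 1 - delta by lra.
have sd : 0 < Num.sqrt (1 - delta) by rewrite sqrtr_gt0.
have sm : 0 < Num.sqrt m%:R :> R by rewrite sqrtr_gt0.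
rewrite -(@ler_pXn2r _ 2) ?nnegrE ?frob_ge0 //; last first.
  by rewrite !mulr_ge0 ?invr_ge0 // ltW.
have -> : (2 / Num.sqrt (1 - delta) * eps / Num.sqrt m%:R) ^+ 2 =
   (m%:R^-1 * (2 * eps) ^+ 2) / (1 - delta).
  rewrite -[in RHS](sqr_sqrtr (ltW d1')) -[in RHS](sqr_sqrtr (ltW mp)).
  by field; rewrite !gt_eqF.
by rewrite ler_pdivlMr // mulrC.
Qed.

End Recovery.

(** * Transfer from finitely supported laws to general ones *)

Lemma random_nuclear_isometry (R : realType) (c5 delta : R) :
  0 < c5 -> 0 < delta < 1 ->
  exists2 c0 : R, 0 < c0 &
  exists N : nat, forall n : nat, (N <= n)%N ->
  forall (d : measure_display) (T : measurableType d) (P : probability T R)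
         (m r : nat) (K : R) (B : 'I_m -> T -> 'M[R]_n),
    (0 < r <= n)%N -> (0 < m)%N ->
    iid_mx P B ->
    K <= n%:R ^+ 2 ->
    (forall i, {ae P, forall w, spec_norm (B i w) <= K}) ->
    (forall i, opnormF (fun X => EBstarB P (B i) X - X) <= c5 / n%:R) ->
    c0 * r%:R * K ^+ 2 * ln n%:R ^+ 7 < m%:R ->
    exists E : set T, [/\ measurable E, ((1 - (n%:R ^+ 2)^-1)%:E <= P E)%E &
      forall w, E w -> forall X : 'M[R]_n, frob X = 1 ->
        (forall G c, 0 <= c -> op_bound G c -> mxdot G X <= Num.sqrt r%:R * c) ->
        `|\sum_i mxdot (B i w) X ^+ 2 - m%:R| <= delta * m%:R].
Proof.
move=> c50 /andP[delta0 delta1].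
have [|eta [c0 [eta0 eta1 c00 [N0 fin]]]] := @finite_nuclear_isometry R (delta / 2).
  by apply/andP; split; lra.
exists c0 => //; exists (N0 + Num.bound (2 * c5 / eta) + 1)%N.
move=> n hN d T P m r K B rn m0 [mB indep ident] Kn aeB opB hm.
have nN0 : (N0 <= n)%N by apply: leq_trans hN; rewrite -addnA leq_addr.
have n1 : (0 < n)%N by apply: leq_trans hN; rewrite addn1.
have np : 0 < n%:R :> R by rewrite ltr0n.
have n1R : 1 <= n%:R :> R by rewrite ler1n.
have c5n : c5 / n%:R <= eta / 2.
  have hb : 2 * c5 / eta <= n%:R.
    apply: le_trans (ltW (archi_boundP _)) _; first by rewrite !mulr_ge0 ?invr_ge0 // ltW.
    by rewrite ler_nat; apply: leq_trans hN; rewrite addnAC leq_addl.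
  by rewrite ler_pdivrMr //; move: hb; rewrite ler_pdivrMr //; lra.
pose i0 := Ordinal m0.
have K0 : 0 <= K.
  have [w hw] := ae_nonempty (aeB i0).
  exact: op_bound_ge0 n1 (op_bound_spec_norm hw).
(* Rounding error allowed: at most [eta / 2] in the second moment, where [c5 / n] takes the other
   half, and at most [delta / 2] in the isometry, where the finite statement takes the other
   half. *)
pose t := eta * delta / 2.
have t0 : 0 < t by rewrite /t !mulr_gt0.
have t_eta : t <= eta / 2.
  have : eta * delta <= eta by rewrite ler_piMr ?(ltW delta1) // ltW.
  by rewrite /t; lra.
have t_delta : t <= delta / 2.
  have : eta * delta <= delta by rewrite ler_piMl ?(ltW eta1) // ltW.
  by rewrite /t; lra.
pose h := t / (2 * n%:R ^+ 3 * (K + 1)).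
have den0 : 0 < 2 * n%:R ^+ 3 * (K + 1).
  by rewrite !mulr_gt0 ?exprn_gt0 //; lra.
have h0 : 0 < h by rewrite /h divr_gt0.
have h3 : 2 * n%:R ^+ 3 * K * h <= t.
  have -> : t = 2 * n%:R ^+ 3 * (K + 1) * h by rewrite /h mulrC divfK // gt_eqF.
  by rewrite ler_pM2r // ler_pM2l ?mulr_gt0 ?exprn_gt0 //; lra.
have h2 : 2 * n%:R ^+ 2 * K * h <= t.
  apply: le_trans h3; rewrite ler_pM2r // ler_wpM2r // ler_pM2l //.
  by rewrite ler_weXn2l.
pose L := (Num.truncn (2 * K / h)).+1.
have KL : 2 * K < L%:R * h by rewrite -ltr_pdivrMr // truncnS_gt.
have [rep [rep_op repK]] := @quant_rep R n L K h K0.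
pose Y i w := quant L K h (B i w).
have mY i f : measurable (Y i @^-1` [set f]) by exact: quant_measurable_preimage (mB i) f.
pose p := cell_mass P (Y i0).
have p0 : forall f, 0 <= p f := cell_mass_ge0 P (Y i0).
have p1 : \sum_f p f = 1 := cell_mass_sum1 P (mY i0).
have mom X : frob X = 1 -> `|\sum_f p f * mxdot (rep f) X ^+ 2 - 1| <= eta.
  move=> fX; apply: (le_trans (finite_second_moment K0 h0 KL rep_op repK (mB i0) (aeB i0) (opB i0) fX)).
  by lra.
(* For [K = 0] all second moments would vanish, although they lie within [eta < 1] of 1. *)
have Kp : 0 < K.
  rewrite lt_neqAle K0 andbT eq_sym; apply/eqP => K00.
  pose X : 'M[R]_n := delta_mx (Ordinal n1) (Ordinal n1).
  have fX : frob X = 1.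
    rewrite /frob (bigD1 (Ordinal n1)) //= (bigD1 (Ordinal n1)) //= mxE !eqxx expr1n.
    rewrite big1 => [|j /negbTE ne]; last by rewrite mxE ne andbF expr0n.
    rewrite big1 => [|i /negbTE ne]; first by rewrite !addr0 sqrtr1.
    by rewrite big1 // => j _; rewrite mxE ne expr0n.
  have := mom X fX; rewrite big1 => [|f _]; first by rewrite add0r normrN normr1 leNgt eta1.
  have -> : mxdot (rep f) X = 0; last by rewrite expr0n mulr0.
  have := rep_mxdot K0 rep_op f X; rewrite K00 mulr0 mul0r normr_le0 => /eqP.
  by [].
pose W w : {ffun 'I_m -> {ffun 'I_n * 'I_n * 'I_L -> bool}} := [ffun i => Y i w].
have WE om : W @^-1` [set om] = \bigcap_i (B i @^-1` (quant L K h @^-1` [set om i])).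
  apply/seteqP; split=> w /=; first by move=> <- i _ /=; rewrite ffunE.
  by move=> hw; apply/ffunP => i; rewrite ffunE; exact: hw.
have mW om : measurable (W @^-1` [set om]).
  rewrite WE; apply: fin_bigcap_measurable => [|i _]; first exact: finite_finset.
  exact: mY.
(* Independence and identical distribution enter here, through the cells only. *)
have massW om : cell_mass P W om = law p om.
  rewrite /cell_mass WE indep; last by move=> i; exact: quant_measurable.
  apply: eq_bigr => i _; congr fine; apply: (ident i i0); exact: quant_measurable.
pose good (om : {ffun 'I_m -> {ffun 'I_n * 'I_n * 'I_L -> bool}}) :=
  `[< nuclear_isometry rep (delta / 2) r om >].
have [mE0 PE0] := simple_prob P mW good.
set E0 := W @^-1` _ in mE0 PE0.
have hE0 : 1 - (n%:R ^+ 2)^-1 <= fine (P E0).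
  rewrite PE0; under eq_bigr => om _ do rewrite massW.
  have := fin n nN0 m r K _ p rep p0 p1 rn Kp Kn rep_op mom hm.
  have : \sum_om law p om * (good om)%:R = 1 - \sum_(om : {ffun 'I_m -> _}) law p om * (~~ good om)%:R.
    rewrite -[X in X - _](law_sum1 m p1) -sumrB; apply: eq_bigr => om _.
    by case: (good om); rewrite ?mulr1 ?mulr0 ?subr0 ?subrr.
  by rewrite /good; lra.
(* The norm bounds hold only almost surely; removing a measurable null set keeps the event
   measurable and its probability intact. *)
have [Nl [mNl Nl0 hNl]] : P.-negligible (~` [set w | forall i, spec_norm (B i w) <= K]).
  exact: filter_forall aeB.
exists (E0 `\` Nl); split.
- exact: measurableD.
- apply: (@le_trans _ _ (P E0)); first by rewrite -(fineK (fin_num_measure P _ mE0)) lee_fin.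
  apply: (@le_trans _ _ (P ((E0 `\` Nl) `|` Nl))).
    apply: le_measure; rewrite ?inE //; first by apply: measurableU => //; exact: measurableD.
    by move=> w E0w /=; have [|] := pselect (Nl w); [right|left].
  by rewrite -[leRHS]adde0 -Nl0; apply: measureU2 => //; exact: measurableD.
move=> w [gw Nw] X fX hX.
have opBw i : op_bound (B i w) K.
  apply: op_bound_spec_norm; move: i.
  by apply: contrapT => hw; apply: Nw; apply: hNl.
have /asboolP iso : good (W w) := gw.
have h1 := iso X fX hX.
have h4 : `|\sum_i (mxdot (B i w) X ^+ 2 - mxdot (rep (W w i)) X ^+ 2)| <= delta / 2 * m%:R.
  apply: (le_trans (ler_norm_sum _ _ _)).
  apply: (@le_trans _ _ (\sum_(i < m) delta / 2)); last by rewrite sumr_const card_ord mulr_natr.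
  apply: ler_sum => i _; rewrite ffunE; apply: (le_trans (rep_close_sqr K0 h0 KL rep_op repK (opBw i) fX)).
  exact: le_trans h2 t_delta.
have -> : \sum_i mxdot (B i w) X ^+ 2 - m%:R =
   \sum_i (mxdot (B i w) X ^+ 2 - mxdot (rep (W w i)) X ^+ 2) +
   (\sum_i mxdot (rep (W w i)) X ^+ 2 - m%:R).
  by rewrite sumrB; ring.
by apply: (le_trans (ler_normD _ _)); lra.
Qed.

Theorem theorem5 (R : realType) (c5 delta : R) :
  0 < c5 -> 0 < delta < 1 ->
  exists c0 C2 : R, 0 < c0 /\ 0 < C2 /\
  exists N : nat, forall n : nat, (N <= n)%N ->
  forall (d : measure_display) (T : measurableType d) (P : probability T R)
         (m r : nat) (K : R) (B : 'I_m -> T -> 'M[R]_n),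
    iid_mx P B ->
    K <= n%:R ^+ 2 ->
    (forall i, {ae P, forall w, spec_norm (B i w) <= K}) ->
    (forall i, opnormF (fun X => EBstarB P (B i) X - X) <= c5 / n%:R) ->
    m%:R > c0 * r%:R * K ^+ 2 * (ln n%:R) ^+ 7 ->
    exists E : set T, measurable E /\
      ((1 - (n%:R ^+ 2)^-1)%:E <= P E)%E /\
      forall w, E w ->
        (forall X : 'M[R]_n, (\rank X <= r)%N ->
           `| m%:R^-1 * norm2 (meas (fun i => B i w) X) ^+ 2 - frob X ^+ 2 |
             <= delta * frob X ^+ 2) /\
        (forall (Kset : set 'M[R]_n) (eps2 : R) (Sigma : 'M[R]_n) (y : 'cV[R]_m),
           convex_set (Kset : set (convex_lmodType 'M[R]_n)) ->
           0 <= eps2 -> Kset Sigma -> (\rank Sigma <= r)%N ->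
           norm2 (y - meas (fun i => B i w) Sigma) <= eps2 ->
           forall Sigmahat : 'M[R]_n,
             (norm2 (y - meas (fun i => B i w) Sigmahat) <= eps2 /\ Kset Sigmahat) ->
             (forall M : 'M[R]_n,
                norm2 (y - meas (fun i => B i w) M) <= eps2 -> Kset M ->
                nucnorm Sigmahat <= nucnorm M) ->
             frob (Sigmahat - Sigma) <= C2 * eps2 / Num.sqrt m%:R).
Proof.
move=> c50 delta01; have /andP[delta0 delta1] := delta01.
have [c0 c00 [N main]] := random_nuclear_isometry c50 delta01.
(* The 8 comes from the cone of minimizer errors. In [C2] the 2 counts the two feasible residuals,
   and the root comes from the lower isometry bound. *)
exists (8 * c0), (2 / Num.sqrt (1 - delta)); split; first by rewrite mulr_gt0.
have sd : 0 < Num.sqrt (1 - delta) by rewrite sqrtr_gt0 subr_gt0.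
split; first by rewrite divr_gt0.
exists N.+1 => n hN d T P m r K B iidB Kn aeB opB hm.
have n0 : (0 < n)%N by apply: leq_trans hN.
have y0 : 0 <= ln n%:R :> R by rewrite ln_ge0 // ler1n.
have m0 : (0 < m)%N.
  rewrite -(ltr0n R); apply: le_lt_trans hm.
  apply: mulr_ge0 (exprn_ge0 7 y0); apply: mulr_ge0 (sqr_ge0 K).
  by apply: mulr_ge0 => //; apply: mulr_ge0 => //; exact: ltW.
have [E [mE PE hE]] : exists E : set T,
    [/\ measurable E, ((1 - (n%:R ^+ 2)^-1)%:E <= P E)%E &
      forall w, E w -> forall X : 'M[R]_n, frob X = 1 ->
        (forall G c, 0 <= c -> op_bound G c ->
           mxdot G X <= Num.sqrt (minn (8 * r) n)%:R * c) ->
        `|\sum_i mxdot (B i w) X ^+ 2 - m%:R| <= delta * m%:R].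
  (* For [r = 0] the cone contains no matrix of norm 1, as testing [X] against itself shows, so the
     whole space serves as the event. *)
  have [r0|r0] := posnP r.
    exists setT; split=> //.
      by rewrite probability_setT lee_fin gerBl invr_ge0 exprn_ge0.
    move=> w _ X fX hX; exfalso.
    have := hX X (frob X) (frob_ge0 X) (op_bound_schatten 0 X).
    by rewrite r0 muln0 min0n sqrtr0 mul0r -frob_sqr fX expr1n ler10.
  apply: (main n (ltnW hN) d T P m (minn (8 * r) n) K B) => //.
    by rewrite leq_min n0 muln_gt0 r0 geq_minr.
  apply: le_lt_trans hm; rewrite ler_wpM2r ?exprn_ge0 // ler_wpM2r ?exprn_even_ge0 //.
  by rewrite (mulrC 8 c0) -mulrA ler_pM2l // -natrM ler_nat geq_minl.
exists E; split=> //; split=> // w Ew.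
have iso := hE w Ew.
split=> [X rX|Kset eps2 S y _ eps0 KS rS hS Shat [hShat KShat] hmin].
  exact: (rank_isometry m0 iso).
exact: (nuclear_recovery delta01 m0 iso rS hS hShat (hmin S hS KS)).
Qed.
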